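(* Let $\mathcal{G}$ be a connected compact finite metric graph with Dirichlet set $D$ and at least one Neumann pendant vertex $v$ (a pendant vertex not in $D$). Let $\lambda>0$ be a sharp eigenvalue of $L(\mathcal{G},D)$, $\lambda=\lambda_n(\mathcal{G})$ with $n$ its smallest index. Let $j\in\mathbb{N}=\{1,2,\dots\}$, $\ell=2j\pi/\sqrt{\lambda}$, and let $\mathcal{G}_v$ be the graph obtained by attaching a loop of length $\ell$ to $\mathcal{G}$ at $v$ (both endpoints of a new edge of length $\ell$ are identified with $v$), with standard (continuity and Kirchhoff) vertex conditions at $v$ and all other vertex conditions unchanged. Then $\lambda=\lambda_{n_v}(\mathcal{G}_v)$ with smallest index $n_v=n+2j-1$, and $\lambda$ is a sharp degenerate eigenvalue of $\mathcal{G}_v$. In particular, the multiplicity of $\lambda$ increases by one going from $\mathcal{G}$ to $\mathcal{G}_v$.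
   Context: A compact finite metric graph $\mathcal{G}$ is the quotient of a disjoint union of finitely many compact intervals of positive length (edges) $e_i=[x_{2i-1},x_{2i}]$ by an equivalence relation on the set of endpoints; the equivalence classes are the vertices. Loops and multiple edges are allowed. The degree of a vertex is the number of interval endpoints in its class; a pendant vertex is a vertex of degree one. $\mathcal{L}$ denotes the total length (sum of the edge lengths) and $\beta=|E|-|V|+1$ the first Betti number. Given a subset $D$ of the pendant vertices (the Dirichlet vertices), $L(\mathcal{G},D)$ acts as $-\frac{d^2}{dx^2}$ on each edge, on functions $f\in\bigoplus_i H^2[x_{2i-1},x_{2i}]$ that are continuous on $\mathcal{G}$, satisfy $f(v)=0$ for all $v\in D$, and satisfy the Kirchhoff condition $\sum_{x_j\in v}\partial f(x_j)=0$ at every vertex $v\notin D$, where $\partial f(x_{2i-1})=f'(x_{2i-1})$ and $\partial f(x_{2i})=-f'(x_{2i})$. It is self-adjoint in $L_2(\mathcal{G})$ with discrete spectrum $0\le\lambda_1\le\lambda_2\le\dots$ (counted with multiplicity). Eigenvalues of a graph mean eigenvalues of its Laplacian. $\mathcal{D}=|D|$ and $\mathcal{N}$ is the number of pendant vertices not in $D$. Define for $n\in\mathbb{N}=\{1,2,\dots\}$ $$M_n=\frac{\pi^2}{\mathcal{L}^2}\Big(n-2+\mathcal{D}+\frac{\mathcal{N}+\beta}{2}+\beta\Big)^2,$$ and, for $n\ge2$, or for $n\geq 1$ if $\mathcal{D}\ne0$, $$m_n=\begin{cases}\frac{\pi^2}{\mathcal{L}^2}\frac{n^2}{4}& n<\mathcal{N}+\beta,\\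 \frac{\pi^2}{\mathcal{L}^2}\big(n-\frac{\mathcal{N}+\beta}{2}\big)^2& n\ge\mathcal{N}+\beta.\end{cases}$$ (If $\mathcal{D}=0$ then $\lambda_1=0$, so the case $n=1$, $\mathcal{D}=0$ does not occur for positive $\lambda$.) $\lambda_n$ is lower sharp if $\lambda_n=m_n$ and upper sharp if $\lambda_n=M_n$. An eigenvalue $\lambda=\lambda_n=\dots=\lambda_{n+m-1}$ of multiplicity $m\ge1$ ($n$ the smallest index) is sharp if $\lambda_n$ is upper sharp and $\lambda_{n+m-1}$ is lower sharp; it is a sharp degenerate eigenvalue if moreover $m\ge2$. *)

(* Defs.v *)
From HB Require Import structures.
From mathcomp Require Import all_boot all_order all_algebra.
From mathcomp Require Import all_classical all_reals all_analysis.

Set Implicit Arguments.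
Unset Strict Implicit.
Unset Printing Implicit Defensive.

Import Order.TTheory GRing.Theory Num.Theory.
Import numFieldNormedType.Exports.

Local Open Scope classical_set_scope.
Local Open Scope ring_scope.

(* The edge e is the interval [endpt e false, endpt e true].  Its two endpoints
   are (e, false) and (e, true); two endpoints are identified exactly when
   vtx sends them to the same vertex, so that vertices stand for the classes
   of the equivalence relation on endpoints (hence surjectivity). *)
Record metric_graph (R : realType) := MetricGraph {
  edge : finType;
  vertex : finType;
  endpt : edge -> bool -> R;
  endpt_lt : forall e, endpt e false < endpt e true;
  vtx : edge * bool -> vertex;
  vtx_surj : forall v, exists x, vtx x = v
}.

Section Combinatorics.
Context {R : realType}.
Implicit Type G : metric_graph R.

Definition adjacent G : rel (vertex G) := fun u w =>
  [exists e : edge G, exists b : bool,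
    (vtx (e, b) == u) && (vtx (e, ~~ b) == w)].

Definition connected_graph G : Prop :=
  forall u w : vertex G, connect (@adjacent G) u w.

Definition degree G (v : vertex G) : nat :=
  #|[pred x : edge G * bool | vtx x == v]|.

Definition pendants G : {set vertex G} := [set v | degree v == 1%N].

Definition total_length G : R :=
  \sum_(e : edge G) (endpt e true - endpt e false).

Definition betti G : int := #|edge G|%:Z - #|vertex G|%:Z + 1.

Definition nDirichlet G (D : {set vertex G}) : nat := #|D|.

Definition nNeumann G (D : {set vertex G}) : nat := #|pendants G :\: D|.

End Combinatorics.

Section AttachLoop.
Context {R : realType}.
Variables (G : metric_graph R) (v : vertex G) (l : R).
Hypothesis l_gt0 : 0 < l.

(* The new edge None is [0, l], both of its endpoints being sent to v.  The
   vertex type is left unchanged, so that a Dirichlet set of G is also a set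
   of vertices of attach_loop. *)
Definition loop_endpt (e : option (edge G)) (b : bool) : R :=
  if e is Some e' then endpt e' b else if b then l else 0.

Definition loop_vtx (x : option (edge G) * bool) : vertex G :=
  if x.1 is Some e then vtx (e, x.2) else v.

Lemma loop_endpt_lt e : loop_endpt e false < loop_endpt e true.
Proof. by case: e => [e|] //=; exact: endpt_lt. Qed.

Lemma loop_vtx_surj w : exists x, loop_vtx x = w.
Proof. by have [[e b] <-] := vtx_surj w; exists (Some e, b). Qed.

Definition attach_loop : metric_graph R :=
  MetricGraph loop_endpt_lt loop_vtx_surj.

End AttachLoop.

Section Laplacian.
Context {R : realType}.
Local Notation mu := (@lebesgue_measure R).

(* f (restricted to [a, b]) is in H^2[a, b], with f' = p everywhere on [a, b]
   (one-sided at a and b) and weak second derivative g in L^2. *)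
Definition sobolev2 (a b : R) (f p g : R -> R) : Prop :=
  [/\ measurable_fun `[a, b] g,
      mu.-integrable `[a, b] (EFin \o (fun x => g x ^+ 2)),
      (forall x, x \in `[a, b] -> p x = p a + \int[mu]_(t in `[a, x]) g t) &
      (forall x, x \in `[a, b] -> f x = f a + \int[mu]_(t in `[a, x]) p t)].

(* Only the values of a function on edge e in the interval of e matter. *)
Definition graph_fun (G : metric_graph R) : Type := edge G -> R -> R.

Variables (G : metric_graph R) (D : {set vertex G}).

(* f is in the domain of L(G, D) and L(G, D) f = h in L_2(G).  The sign
   (-1) ^+ b turns the derivative at the endpoint (e, b) into the one directed
   into the edge. *)
Definition laplacian (f h : graph_fun G) : Prop :=
  exists p g : graph_fun G,
  [/\ (forall e, sobolev2 (endpt e false) (endpt e true) (f e) (p e) (g e)),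
      (forall e e' : edge G, forall b b' : bool, vtx (e, b) = vtx (e', b') ->
        f e (endpt e b) = f e' (endpt e' b')),
      (forall (e : edge G) (b : bool), vtx (e, b) \in D -> f e (endpt e b) = 0),
      (forall v : vertex G, v \notin D ->
        \sum_(x : edge G * bool | vtx x == v)
          (-1) ^+ x.2 * p x.1 (endpt x.1 x.2) = 0) &
      (forall e, {ae mu, forall x,
        x \in `[endpt e false, endpt e true] -> h e x = - g e x})].

Definition eigenspace_of (z : R) : set (graph_fun G) :=
  [set f | laplacian f (fun e x => z * f e x)].

Definition eq_on_graph (f h : graph_fun G) : Prop :=
  forall (e : edge G) (x : R), x \in `[endpt e false, endpt e true] ->
    f e x = h e x.

Definition lin_comb (k : nat) (c : 'I_k -> R) (f : 'I_k -> graph_fun G) :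
    graph_fun G :=
  fun e x => \sum_(i < k) c i * f i e x.

Definition has_dim (V : set (graph_fun G)) (k : nat) : Prop :=
  exists f : 'I_k -> graph_fun G,
  [/\ (forall i, V (f i)),
      (forall c : 'I_k -> R,
        eq_on_graph (lin_comb c f) (fun _ _ => 0) -> forall i, c i = 0) &
      (forall h, V h -> exists c : 'I_k -> R, eq_on_graph h (lin_comb c f))].

(* s 0 <= s 1 <= ... lists all the eigenvalues, each repeated according to its
   (finite) multiplicity. *)
Definition is_spectrum (s : nat -> R) : Prop :=
  (forall i j : nat, (i <= j)%N -> s i <= s j) /\
  (forall z : R, exists k : nat,
    has_dim (eigenspace_of z) k /\ ([set i | s i = z] #= `I_k)%card).

(* lambda_n for n >= 1; is_spectrum has at most one solution. *)
Definition eigenval (n : nat) : R :=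
  xget (fun=> 0) [set s : nat -> R | is_spectrum s] n.-1.

Definition upper_bound (n : nat) : R :=
  let b : R := (betti G)%:~R in
  pi ^+ 2 / total_length G ^+ 2 *
  (n%:R - 2 + (nDirichlet D)%:R + ((nNeumann D)%:R + b) / 2 + b) ^+ 2.

Definition lower_bound (n : nat) : R :=
  let b : R := (betti G)%:~R in
  if n%:Z < (nNeumann D)%:Z + betti G then
    pi ^+ 2 / total_length G ^+ 2 * (n%:R ^+ 2 / 4)
  else
    pi ^+ 2 / total_length G ^+ 2 * (n%:R - ((nNeumann D)%:R + b) / 2) ^+ 2.

Definition upper_sharp (n : nat) : Prop :=
  (1 <= n)%N /\ eigenval n = upper_bound n.

Definition lower_sharp (n : nat) : Prop :=
  ((2 <= n)%N \/ (1 <= n)%N /\ nDirichlet D <> 0%N) /\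
  eigenval n = lower_bound n.

(* z = lambda_n = ... = lambda_(n + m - 1), with n the smallest index of z and
   m >= 1 its multiplicity. *)
Definition eigenvalue_at (z : R) (n m : nat) : Prop :=
  [/\ (1 <= n)%N, (1 <= m)%N &
      forall k : nat, (1 <= k)%N -> eigenval k = z <-> (n <= k < n + m)%N].

Definition sharp_eigenvalue (z : R) (n m : nat) : Prop :=
  [/\ eigenvalue_at z n m, upper_sharp n & lower_sharp (n + m - 1)].

Definition sharp_degenerate_eigenvalue (z : R) (n m : nat) : Prop :=
  sharp_eigenvalue z n m /\ (2 <= m)%N.

End Laplacian.

(* Main.v *)
Require Import Defs.
From mathcomp Require Import all_boot all_order all_algebra.
From mathcomp Require Import all_classical all_reals all_analysis.
From mathcomp Require Import measurable_realfun ring lra zify.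

Set Implicit Arguments.
Unset Strict Implicit.
Unset Printing Implicit Defensive.

Import Order.TTheory GRing.Theory Num.Theory.
Import numFieldNormedType.Exports.

Local Open Scope classical_set_scope.
Local Open Scope ring_scope.

(** Sharpness only enters the final arithmetic: the index shift holds for every
    positive eigenvalue.  For [z = k^2] with [k > 0] an eigenfunction is
    [a cos(kt) + b sin(kt)] on each edge, and the conditions at the vertices
    other than [v] leave a line of traces (f(v), f'(v) / k) at [v], spanned by
    [(f k, g k)].  Green's identity shows that [r = f / g] is strictly
    decreasing between its poles, which are the eigenvalues of G with an
    eigenfunction that does not vanish at [v].  The loop similarly contributes
    [cot(k l / 2) / 2], and the eigenvalues of the glued graph are governed by
    the zeros of the sum, exactly one of which lies between two consecutive
    poles.  Counting zeros and poles below [sqrt lam = 2 j pi / l], which is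
    itself a pole, gives the shift by [2 j - 1], while at [lam] the only new
    eigenfunction is the sine supported on the loop. *)

(** * Solutions on an edge *)

(** The traces at the vertex [v] have no canonical normalisation. The generators [(f k, g k)] are
    chosen separately for each frequency, with no continuity in [k], so limits of [f] and [g] are
    controlled only up to a sign, which disappears in the quotient. Two facts replace analytic
    dependence on [k]. Green's identity between waves of two different frequencies, divided by their
    difference, tends to a positive definite form in the coefficients; this is what makes the
    quotient strictly decreasing. And unit coefficient vectors stay bounded, so they converge along
    ultrafilters to waves at the limit frequency. Waves with zero trace at [v] can exist as well,
    and the generator is taken orthogonal to them. For [k > 0] the multiplicities satisfy d_v +
    [g = 0] = d + [Robin] + [sin(k l / 2) = 0], where Robin is the vanishing of the sum of the two
    quotients with denominators cleared. Strictly between 0 and [sqrt lam] there are [j] more Robin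
    roots than zeros of [g], and [j - 1] zeros of the sine, which add up to the shift [2 j - 1]. *)

Section Edge.
Context {R : realType}.
Local Notation mu := (@lebesgue_measure R).
Implicit Types (a b k z : R) (f p g : R -> R).

(** The interval has finite measure and [|g|] is at most [1 + g ^+ 2]. *)
Lemma square_integrable_integrable a b g : measurable_fun `[a, b] g ->
  mu.-integrable `[a, b] (EFin \o (fun x => g x ^+ 2)) ->
  mu.-integrable `[a, b] (EFin \o g).
Proof.
move=> mg ig2.
have i1 : mu.-integrable `[a, b] (EFin \o cst (1 : R)).
  apply: continuous_compact_integrable; first exact: segment_compact.
  by apply: continuous_subspaceT => x; exact: cvg_cst.
have := integrableD _ i1 ig2 => /(_ (measurable_itv _)).
apply: le_integrable => //.
  by apply/measurable_EFinP.
move=> x _ /=; rewrite lee_fin.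
have h : 0 <= 1 + g x ^+ 2 by rewrite addr_ge0// sqr_ge0.
rewrite (ger0_norm h) ler_norml.
by apply/andP; split; have := sqr_ge0 (g x + 1); have := sqr_ge0 (g x - 1); nra.
Qed.

Lemma continuous_within_eq (A : set R) (f g : R -> R) :
  {in A, f =1 g} -> {within A, continuous f} -> {within A, continuous g}.
Proof. by move=> fg; exact: subspace_eq_continuous. Qed.

Lemma continuous_segment_integrable a b f :
  {within `[a, b], continuous f} -> mu.-integrable `[a, b] (EFin \o f).
Proof.
by move=> cf; apply: continuous_compact_integrable => //; exact: segment_compact.
Qed.

Lemma primitive_continuous a b f g c : a <= b ->
  mu.-integrable `[a, b] (EFin \o g) ->
  (forall x, x \in `[a, b] -> f x = c + \int[mu]_(t in `[a, x]) g t) ->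
  {within `[a, b], continuous f}.
Proof.
move=> ab ig fE.
apply: (@continuous_within_eq _ (fun x => c + \int[mu]_(t in `[a, x]) g t)).
  by move=> x; rewrite inE /= => /fE.
move=> x; apply: cvgD; first exact: cvg_cst.
exact: (parameterized_integral_continuous ab ig).
Qed.

Lemma primitive_is_derive a b f g c x : x \in `]a, b[ ->
  {within `[a, b], continuous g} ->
  (forall x, x \in `[a, b] -> f x = c + \int[mu]_(t in `[a, x]) g t) ->
  is_derive x 1 f (g x).
Proof.
move=> xab cg fE.
have /andP[ax xb] : a < x < b by move: xab; rewrite in_itv.
have ab := lt_trans ax xb.
have [dF FE] := continuous_FTC1_closed xb (continuous_segment_integrable cg) ax
  (within_continuous_continuous ab cg xab).
apply: (@near_eq_is_derive _ _ _ (fun x => c + \int[mu]_(t in `[a, x]) g t)).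
  near=> y; rewrite fE // in_itv /=; apply/andP; split; apply: ltW; near: y.
  - exact: lt_nbhsr.
  - exact: lt_nbhsl.
rewrite -[g x]add0r; apply: is_deriveD.
by rewrite -FE derive1E; exact/derivableP.
Unshelve. all: by end_near. Qed.

(** [p] is a primitive of [g], which agrees almost everywhere with the continuous function
    [- z * f]; replacing it under the integral makes the weak equation classical. *)
Lemma sobolev2_ode a b z f p g : a < b -> sobolev2 a b f p g ->
  {ae mu, forall x, x \in `[a, b] -> z * f x = - g x} ->
  [/\ {within `[a, b], continuous f}, {within `[a, b], continuous p},
      (forall x : R, x \in `]a, b[ -> is_derive x 1 f (p x)) &
      (forall x : R, x \in `]a, b[ -> is_derive x 1 p (- z * f x))].
Proof.
move=> ab [mg ig2 pE fE] zfg; have leab := ltW ab.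
have ig := square_integrable_integrable mg ig2.
have cp := primitive_continuous leab ig pE.
have cf := primitive_continuous leab (continuous_segment_integrable cp) fE.
have czf : {within `[a, b], continuous (fun x => - z * f x)}.
  by move=> x; apply: cvgMr; exact: cf.
split=> // x xab; first exact: (primitive_is_derive xab cp fE).
apply: (primitive_is_derive xab czf (c := p a)) => y yab.
rewrite (pE _ yab) /Rintegral; congr (_ + fine _).
have sub : `[a, y] `<=` `[a, b].
  by apply: subset_itvl; rewrite bnd_simp; move: yab; rewrite in_itv => /andP[].
apply: ae_eq_integral => //.
- by apply/measurable_EFinP; apply: measurable_funS mg.
- have /integrableP[+ _] := continuous_segment_integrable czf.
  exact: measurable_funS.
- case: zfg => N [mN N0 subN]; exists N; split=> // t /= nP; apply: subN => tE.
  by apply: nP => tay; rewrite mulNr (tE (sub _ tay)) opprK.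
Qed.

End Edge.

Lemma is_derive_continuous (R : realType) (f : R -> R) (x df : R) :
  is_derive x 1 f df -> {for x, continuous f}.
Proof.
case=> d _; have /derivable1_diffP := d; exact: differentiable_continuous.
Qed.

Lemma is_derive_affine (R : realType) (k a y : R) :
  is_derive y 1 (fun x : R => k * (x - a)) k.
Proof.
have h : is_derive y 1 (fun x : R => x - a) 1.
  by apply: is_derive_eq; rewrite subr0.
have := @is_deriveZ _ _ _ (fun x : R => x - a) k y 1 1 h.
by rewrite /GRing.scale /= mulr1.
Qed.

Lemma is_derive_cos_affine (R : realType) (k a y : R) :
  is_derive y 1 (fun x : R => cos (k * (x - a))) (- (k * sin (k * (y - a)))).
Proof.
rewrite -mulrN mulrC.
exact: (@is_derive1_comp _ cos _ y _ _ (is_derive_cos _) (is_derive_affine k a y)).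
Qed.

Lemma is_derive_sin_affine (R : realType) (k a y : R) :
  is_derive y 1 (fun x : R => sin (k * (x - a))) (k * cos (k * (y - a))).
Proof.
rewrite mulrC.
exact: (@is_derive1_comp _ sin _ y _ _ (is_derive_sin _) (is_derive_affine k a y)).
Qed.

Lemma is_derive_dot (R : realType) (f g p q : R -> R) (e y df dg dp dq : R) :
  is_derive y 1 f df -> is_derive y 1 g dg ->
  is_derive y 1 p dp -> is_derive y 1 q dq ->
  is_derive y 1 (fun x => f x * g x + e * (p x * q x))
    (df * g y + f y * dg + e * (dp * q y + p y * dq)).
Proof.
move=> hf hg hp hq.
have h1 := is_deriveM hf hg; have h2 := is_deriveZ e (is_deriveM hp hq).
have h := is_deriveD h1 h2.
apply: (@is_derive_eq _ _ _ _ _ _ _ _ h).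
by rewrite /GRing.scale /=; ring.
Qed.

(** * The equation f'' = - z f on a single edge *)

Section EdgeEquation.
Context {R : realType}.
Local Notation mu := (@lebesgue_measure R).
Implicit Types (a b k z : R) (f p g : R -> R).

Lemma is_derive0_segment a b f : {within `[a, b], continuous f} ->
  (forall x : R, x \in `]a, b[ -> is_derive x 1 f 0) ->
  {in `[a, b], forall x, f x = f a}.
Proof.
move=> cf df x; rewrite in_itv /= => /andP[].
rewrite le_eqVlt => /predU1P[<-//|ax] xb.
have [y _ /eqP] : exists2 y, y \in `]a, x[%R & f x - f a = 0 * (x - a).
  have dft y : y \in `]a, x[ -> is_derive y 1 f 0.
    move=> yax; apply: df; move: yax; rewrite !in_itv /= => /andP[-> yx] /=.
    exact: lt_le_trans xb.
  have cft : {within `[a, x], continuous f}.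
    by apply: continuous_subspaceW cf; apply: subset_itvl; rewrite bnd_simp.
  exact: (MVT ax dft cft).
by rewrite mul0r subr_eq0 => /eqP.
Qed.

Lemma derive_nneg_segment a b f df : {within `[a, b], continuous f} ->
  (forall x : R, x \in `]a, b[ -> is_derive x 1 f (df x)) ->
  (forall x : R, x \in `]a, b[ -> 0 <= df x) ->
  {in `[a, b] &, {homo f : x y / x <= y}}.
Proof.
move=> cf dfE df0 x y; rewrite !in_itv /= => /andP[ax xb] /andP[ay yb].
rewrite le_eqVlt => /predU1P[<-//|xy].
have sub t : t \in `]x, y[ -> t \in `]a, b[.
  rewrite !in_itv /= => /andP[xt ty].
  by rewrite (le_lt_trans ax xt) (lt_le_trans ty yb).
have [t txy] : exists2 t, t \in `]x, y[%R & f y - f x = df t * (y - x).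
  have dft t : t \in `]x, y[ -> is_derive t 1 f (df t) by move=> /sub /dfE.
  have cft : {within `[x, y], continuous f}.
    by apply: continuous_subspaceW cf; apply: subset_itv; rewrite bnd_simp.
  exact: (MVT xy dft cft).
by rewrite -subr_ge0 => ->; rewrite mulr_ge0 ?subr_ge0 ?(ltW xy) ?df0 ?sub.
Qed.

(** The vector [(f, p / k)] turns at constant angular speed, so rotating it back by the angle
    [k * (x - a)] gives two quantities with zero derivative, equal to the initial data. *)
Lemma ode_trig a b k f p : a < b -> k != 0 ->
  {within `[a, b], continuous f} -> {within `[a, b], continuous p} ->
  (forall x : R, x \in `]a, b[ -> is_derive x 1 f (p x)) ->
  (forall x : R, x \in `]a, b[ -> is_derive x 1 p (- k ^+ 2 * f x)) ->
  {in `[a, b], forall x,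
    f x = f a * cos (k * (x - a)) + p a / k * sin (k * (x - a)) /\
    p x = k * (p a / k * cos (k * (x - a)) - f a * sin (k * (x - a)))}.
Proof.
move=> ab k0 cf cp df dp x xab.
pose C x := cos (k * (x - a)); pose S x := sin (k * (x - a)).
have dC (y : R) : is_derive y 1 C (- (k * S y)) := is_derive_cos_affine k a y.
have dS (y : R) : is_derive y 1 S (k * C y) := is_derive_sin_affine k a y.
have cC : {within `[a, b], continuous C}.
  apply: continuous_subspaceT => y; exact: is_derive_continuous (dC y).
have cS : {within `[a, b], continuous S}.
  apply: continuous_subspaceT => y; exact: is_derive_continuous (dS y).
have C0 : C a = 1 by rewrite /C subrr mulr0 cos0.
have S0 : S a = 0 by rewrite /S subrr mulr0 sin0.
have u1 : f x * C x + - k^-1 * (p x * S x) = f a.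
  rewrite [RHS](_ : _ = f a * C a + - k^-1 * (p a * S a)); last first.
    by rewrite C0 S0; ring.
  apply: (@is_derive0_segment a b (fun x => f x * C x + - k^-1 * (p x * S x))) xab.
  - move=> y; apply: cvgD; last apply: cvgMr; apply: cvgM;
      [exact: cf|exact: cC|exact: cp|exact: cS].
  - move=> y yab.
    have := is_derive_dot (- k^-1) (df y yab) (dC y) (dp y yab) (dS y).
    by congr (is_derive _ _ _ _); field.
have u2 : f x * S x + k^-1 * (p x * C x) = p a / k.
  rewrite [RHS](_ : _ = f a * S a + k^-1 * (p a * C a)); last first.
    by rewrite C0 S0; ring.
  apply: (@is_derive0_segment a b (fun x => f x * S x + k^-1 * (p x * C x))) xab.
  - move=> y; apply: cvgD; last apply: cvgMr; apply: cvgM;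
      [exact: cf|exact: cS|exact: cp|exact: cC].
  - move=> y yab.
    have := is_derive_dot k^-1 (df y yab) (dS y) (dp y yab) (dC y).
    by congr (is_derive _ _ _ _); field.
have cs : C x ^+ 2 + S x ^+ 2 = 1 by rewrite cos2Dsin2.
rewrite -/(C x) -/(S x) -u1 -u2; split.
  by rewrite -[LHS]mulr1 -cs; field.
by rewrite -[LHS]mulr1 -cs; field.
Qed.

Lemma smooth_sobolev2 a b f p g : a < b -> continuous g ->
  (forall x : R, is_derive x 1 f (p x)) ->
  (forall x : R, is_derive x 1 p (g x)) -> sobolev2 a b f p g.
Proof.
move=> ab cg df dp.
have cf : continuous f.
  by move=> x; exact: is_derive_continuous (df x).
have cp : continuous p.
  by move=> x; exact: is_derive_continuous (dp x).
have FTC (F h : R -> R) : continuous F -> continuous h ->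
    (forall x : R, is_derive x 1 F (h x)) ->
    forall x, x \in `[a, b] -> F x = F a + \int[mu]_(t in `[a, x]) h t.
  move=> cF ch dF x; rewrite in_itv /= => /andP[].
  rewrite le_eqVlt => /predU1P[<-//|ax _].
    by rewrite set_itv1 Rintegral_set1 addr0.
  rewrite /Rintegral (@continuous_FTC2 _ h F) //= ?subrKC//.
  - exact: continuous_subspaceT.
  - split.
    + by move=> y _; have [] := dF y.
    + exact: cvg_at_right_filter (cF a).
    + exact: cvg_at_left_filter (cF x).
  - by move=> y _; rewrite derive1E; have [_ ->] := dF y.
split.
- exact: subspace_continuous_measurable_fun (continuous_subspaceT _).
- apply: continuous_segment_integrable; apply: continuous_subspaceT => x.
  by apply: cvgM; exact: cg.
- exact: FTC.
- exact: FTC.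
Qed.

Lemma trig_sobolev2 a b k A B : a < b ->
  sobolev2 a b (fun x => A * cos (k * (x - a)) + B * sin (k * (x - a)))
    (fun x => k * (B * cos (k * (x - a)) - A * sin (k * (x - a))))
    (fun x => - k ^+ 2 * (A * cos (k * (x - a)) + B * sin (k * (x - a)))).
Proof.
move=> ab.
have dF (x : R) : is_derive x 1
    (fun x => A * cos (k * (x - a)) + B * sin (k * (x - a)))
    (k * (B * cos (k * (x - a)) - A * sin (k * (x - a)))).
  have := is_derive_dot B (is_derive_cst A x (1 : R)) (is_derive_cos_affine k a x)
    (is_derive_cst (1 : R) x (1 : R)) (is_derive_sin_affine k a x).
  by congr (is_derive _ _ _ _); [apply/funext => t|]; rewrite /cst; ring.
apply: smooth_sobolev2 => // x.
  by apply: cvgMr; exact: is_derive_continuous (dF x).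
have := is_derive_dot (- (k * A)) (is_derive_cst (k * B) x (1 : R))
  (is_derive_cos_affine k a x) (is_derive_cst (1 : R) x (1 : R)) (is_derive_sin_affine k a x).
by congr (is_derive _ _ _ _); [apply/funext => t|]; rewrite /cst; ring.
Qed.

(* [f p] is nondecreasing, with derivative [p^2 - z f^2]. *)
Lemma ode_neg a b z f p : a < b -> z < 0 ->
  {within `[a, b], continuous f} -> {within `[a, b], continuous p} ->
  (forall x : R, x \in `]a, b[ -> is_derive x 1 f (p x)) ->
  (forall x : R, x \in `]a, b[ -> is_derive x 1 p (- z * f x)) ->
  f a * p a <= f b * p b /\
  (f a * p a = f b * p b -> {in `[a, b], forall x, f x = 0}).
Proof.
move=> ab z0 cf cp df dp; have nz0 : 0 <= - z by rewrite oppr_ge0 ltW.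
have cfp : {within `[a, b], continuous (f \* p)}.
  by move=> y; apply: cvgM; [exact: cf|exact: cp].
have dfp (x : R) : x \in `]a, b[ ->
    is_derive x 1 (f \* p) (p x ^+ 2 + - z * f x ^+ 2).
  move=> xab; have := df x xab; have := dp x xab => dpx dfx.
  have := is_deriveM dfx dpx; congr (is_derive _ _ _ _).
  by rewrite /GRing.scale /=; ring.
have dge0 x : x \in `]a, b[ -> 0 <= p x ^+ 2 + - z * f x ^+ 2.
  by move=> _; apply: addr_ge0 (sqr_ge0 _) (mulr_ge0 nz0 (sqr_ge0 _)).
have mono := derive_nneg_segment cfp dfp dge0.
have aab : a \in `[a, b] by rewrite in_itv /= lexx ltW.
have bab : b \in `[a, b] by rewrite in_itv /= lexx ltW.
split=> [|e]; first exact: mono (ltW ab).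
(* Equal end values freeze the monotone product [f p], so its derivative, a sum of two nonnegative
   terms, vanishes. *)
have fp0 x : x \in `[a, b] -> f x * p x = f a * p a.
  move=> xab; have := xab; rewrite in_itv /= => /andP[ax xb].
  by apply: le_anti; rewrite {1}e; apply/andP; split; apply: mono.
have f0 (x : R) : x \in `]a, b[ -> f x = 0.
  move=> xab; have [_ dE] := dfp x xab.
  have : is_derive x 1 (f \* p) 0.
    apply: (@near_eq_is_derive _ _ _ (fun=> f a * p a)).
    have /andP[ax xb] : a < x < b by move: xab; rewrite in_itv.
    near=> y; rewrite /= fp0 // in_itv /=; apply/andP; split; apply: ltW; near: y.
    - exact: lt_nbhsr.
    - exact: lt_nbhsl.
  move=> [_]; rewrite dE => /eqP; rewrite (paddr_eq0 (sqr_ge0 _) (mulr_ge0 nz0 (sqr_ge0 _))).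
  by move=> /andP[_]; rewrite mulf_eq0 oppr_eq0 (lt_eqF z0) /= sqrf_eq0 => /eqP.
(* Continuity carries the vanishing to the endpoints: [f] is constant on the closed interval and
   zero at the midpoint. *)
have fa : {in `[a, b], forall x, f x = f a}.
  apply: is_derive0_segment => // x xab.
  apply: (@near_eq_is_derive _ _ _ (fun=> 0)).
  have /andP[ax xb] : a < x < b by move: xab; rewrite in_itv.
  near=> y; rewrite f0 // in_itv /=; apply/andP; split; near: y.
  - exact: lt_nbhsr.
  - exact: lt_nbhsl.
move=> x xab; rewrite fa // -(fa ((a + b) / 2)).
  by apply: f0; rewrite in_itv /= !midf_lt.
by rewrite in_itv /= !midf_le // ltW.
Unshelve. all: by end_near. Qed.

End EdgeEquation.

(** * Dimensions *)

Lemma eq_double_eq0 (V : zmodType) (x : V) : x = x + x -> x = 0.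
Proof. by move=> /esym/eqP; rewrite -subr_eq0 addrK => /eqP. Qed.

Section Dimension.
Context {R : realType} (G : metric_graph R).
Implicit Types V : set (graph_fun G).

Lemma has_dim_leq V k k' : has_dim V k -> has_dim V k' -> (k <= k')%N.
Proof.
move=> [f [Vf fli _]] [f' [_ _ f'sp]]; rewrite leqNgt; apply/negP => k'k.
have /choice[C CE] i : exists c, eq_on_graph (f i) (lin_comb c f').
  exact: f'sp (Vf i).
pose M := \matrix_(i, j) C i j.
(* With more rows than columns, [M] has a nonzero row vector in its kernel, which is a linear
   relation between the [f i]. *)
have /rowV0Pn[c /sub_kermxP cM c0] : kermx M != 0.
  rewrite -mxrank_eq0 mxrank_ker -lt0n subn_gt0.
  exact: leq_ltn_trans (rank_leq_col _) k'k.
case/negP: c0; apply/eqP/rowP => i; rewrite mxE.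
apply: (fli (c 0)) => e x xe; rewrite /lin_comb.
under eq_bigr => a _ do rewrite CE // /lin_comb mulr_sumr.
rewrite exchange_big /= big1 // => b _.
under eq_bigr => a _ do rewrite mulrA.
rewrite -mulr_suml; have := congr1 (fun A : 'rV_k' => A 0 b) cM.
rewrite !mxE; under eq_bigr do rewrite mxE; move=> ->.
by rewrite mul0r.
Qed.

Lemma has_dim_unique V k k' : has_dim V k -> has_dim V k' -> k = k'.
Proof. by move=> h h'; apply/anti_leq; rewrite !(@has_dim_leq V). Qed.

Lemma has_dim0 V :
  (forall h, V h -> eq_on_graph h (fun _ _ => 0)) -> has_dim V 0.
Proof.
move=> V0; exists (fun i : 'I_0 => fun _ _ => 0); split=> [[]//|c _ []//|h Vh].
by exists (fun=> 0) => e x xe; rewrite (V0 h Vh) // /lin_comb big_ord0.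
Qed.

(** Dimensions of function spaces, taken modulo equality on the graph, become ranks of matrices. *)
Lemma has_dim_param V n (U : 'M[R]_n) (phi : 'rV[R]_n -> graph_fun G) :
  (forall c a b e x, phi (c *: a + b) e x = c * phi a e x + phi b e x) ->
  (forall w, (w <= U)%MS -> V (phi w)) ->
  (forall w, (w <= U)%MS -> eq_on_graph (phi w) (fun _ _ => 0) -> w = 0) ->
  (forall h, V h -> exists2 w, (w <= U)%MS & eq_on_graph h (phi w)) ->
  has_dim V (\rank U).
Proof.
move=> phiD Vphi phi_inj phi_surj.
have phi0 e x : phi 0 e x = 0.
  by have := phiD 1 0 0 e x; rewrite scaler0 addr0 mul1r => /eq_double_eq0.
pose f (i : 'I_(\rank U)) := phi (row i (row_base U)).
have fE (c : 'rV_(\rank U)) e x :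
    lin_comb (c 0) f e x = phi (c *m row_base U) e x.
  rewrite /lin_comb mulmx_sum_row.
  apply: (big_rec2 (fun y w => y = phi w e x)) => [|i y w _ ->] /=.
    by rewrite phi0.
  by rewrite phiD.
exists f; split.
- by move=> i; apply: Vphi; rewrite -(eq_row_base U) row_sub.
- move=> c c0 i; have : (\row_j c j) *m row_base U = 0.
    apply: phi_inj; first by rewrite -(eq_row_base U) submxMl.
    move=> e x xe; rewrite -fE -(c0 e x xe) /lin_comb.
    by apply: eq_bigr => j _; rewrite mxE.
  have /row_free_inj inj := row_base_free U.
  rewrite -(mul0mx _ (row_base U)) => /inj /rowP /(_ i).
  by rewrite !mxE.
- move=> h /phi_surj[w]; rewrite -(eq_row_base U) => /submxP[c ->] hE.
  by exists (c 0) => e x xe; rewrite hE // fE.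
Qed.

(** Each linear condition lowers the dimension by at most one. *)
Lemma solution_space n (I : finType) (q : I -> 'rV[R]_n -> R) :
  (forall i c a b, q i (c *: a + b) = c * q i a + q i b) ->
  exists2 U : 'M[R]_n, (forall w, (w <= U)%MS <-> forall i, q i w = 0) &
    (n <= \rank U + #|I|)%N.
Proof.
move=> qlin; pose M := \matrix_(a < n, i < #|I|) q (enum_val i) (delta_mx 0 a).
have q0 i : q i 0 = 0.
  by have := qlin i 1 0 0; rewrite scaler0 addr0 mul1r => /eq_double_eq0.
have ME (w : 'rV_n) i : (w *m M) 0 i = q (enum_val i) w.
  rewrite {2}(row_sum_delta w) mxE.
  apply: (big_rec2 (fun y w => y = q (enum_val i) w)) => [|a y v _ ->] /=.
    by rewrite q0.
  by rewrite qlin mxE.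
exists (kermx M).
  move=> w; split=> [/sub_kermxP wM i|wq].
    by rewrite -(enum_rankK i) -ME wM mxE.
  by apply/sub_kermxP/rowP => i; rewrite ME wq mxE.
by rewrite mxrank_ker -leq_subLR; have := rank_leq_col M; lia.
Qed.

(** The form either vanishes on [U] or cuts out a hyperplane of it. The test is a Boolean supplied
    by the caller, so that it can be a concrete condition such as [g != 0]. *)
Lemma rank_hyperplane n (U : 'M[R]_n) (q : 'rV[R]_n -> R) :
  (forall c a b, q (c *: a + b) = c * q a + q b) ->
  exists2 W : 'M[R]_n, (forall w, (w <= W)%MS <-> (w <= U)%MS /\ q w = 0) &
    forall b : bool, (b <-> exists2 w, (w <= U)%MS & q w != 0) ->
      (\rank W + b)%N = \rank U.
Proof.
move=> qlin; pose M := \matrix_(a < n, i < 1) q (delta_mx 0 a).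
have q0 : q 0 = 0.
  by have := qlin 1 0 0; rewrite scaler0 addr0 mul1r => /eq_double_eq0.
have ME (w : 'rV_n) : (w *m M) 0 0 = q w.
  rewrite {2}(row_sum_delta w) mxE.
  apply: (big_rec2 (fun y w => y = q w)) => [|a y v _ ->] /=; first by rewrite q0.
  by rewrite qlin mxE.
exists (U :&: kermx M)%MS.
  move=> w; rewrite sub_capmx; split.
    by move=> /andP[-> /sub_kermxP wM]; rewrite -ME wM mxE.
  move=> [-> wq]; apply/sub_kermxP/rowP => i.
  by rewrite ord1 ME wq mxE.
move=> b bE; rewrite -[RHS](mxrank_mul_ker U M) addnC; congr (_ + _)%N.
have -> : \rank (U *m M) = (U *m M != 0).
  by have := rank_leq_col (U *m M); rewrite -mxrank_eq0; case: (\rank _) => [|[]].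
congr nat_of_bool; apply/idP/idP.
  move=> /bE[w /submxP[c ->]]; rewrite -ME -mulmxA; apply: contraNneq => ->.
  by rewrite mulmx0 mxE.
move=> /eqP UM; apply/bE; apply: contrapT => nw; apply: UM.
apply/matrixP => i j; rewrite (ord1 j) [RHS]mxE.
have -> : (U *m M) i 0 = (row i U *m M) 0 0 by rewrite -row_mul [in RHS]mxE.
rewrite ME; apply/eqP; apply: contrapT => /negP qi.
by apply: nw; exists (row i U); rewrite ?row_sub.
Qed.

End Dimension.

(** * Waves on a graph *)

Section Waves.
Context {R : realType} (G : metric_graph R) (D : {set vertex G}).
Local Notation endpoint := (edge G * bool)%type.
Implicit Types (k : R) (w : endpoint -> R) (X : {set vertex G}).

(** Endpoints serve as indices because there are two coefficients per edge: [(e, false)] holds the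
    amplitude of the cosine and [(e, true)] that of the sine. The coefficient space is thus the same
    for all frequencies. *)
Definition wave k w : graph_fun G := fun e x =>
  w (e, false) * cos (k * (x - endpt e false)) +
  w (e, true) * sin (k * (x - endpt e false)).

Definition dwave k w : graph_fun G := fun e x =>
  w (e, true) * cos (k * (x - endpt e false)) -
  w (e, false) * sin (k * (x - endpt e false)).

Definition value k w (x : endpoint) := wave k w x.1 (endpt x.1 x.2).

(* The derivative divided by the frequency, so that the vertex conditions do
   not depend on [k] and make sense at [k = 0]. *)
Definition flux k w (x : endpoint) := (-1) ^+ x.2 * dwave k w x.1 (endpt x.1 x.2).

(** [X] is the set of vertices released from Kirchhoff's condition: the empty set gives the
    eigenwaves, and [[set v]] leaves [v] free to be glued to something else. *)
Definition quasi X k w :=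
  [/\ forall x y, vtx x = vtx y -> value k w x = value k w y,
      forall x, vtx x \in D -> value k w x = 0 &
      forall u, u \notin D -> u \notin X -> \sum_(x | vtx x == u) flux k w x = 0].

Definition edge_length (e : edge G) := endpt e true - endpt e false.

Lemma edge_length_gt0 e : 0 < edge_length e.
Proof. by rewrite subr_gt0 endpt_lt. Qed.

Lemma wave_lin k c w w' e x :
  wave k (fun y => c * w y + w' y) e x = c * wave k w e x + wave k w' e x.
Proof. by rewrite /wave; ring. Qed.

Lemma value_lin k c w w' x :
  value k (fun y => c * w y + w' y) x = c * value k w x + value k w' x.
Proof. exact: wave_lin. Qed.

Lemma flux_lin k c w w' x :
  flux k (fun y => c * w y + w' y) x = c * flux k w x + flux k w' x.
Proof. by rewrite /flux /dwave; ring. Qed.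

Lemma quasi_lin X k c w w' : quasi X k w -> quasi X k w' ->
  quasi X k (fun y => c * w y + w' y).
Proof.
move=> [w1 w2 w3] [v1 v2 v3]; split=> [x y xy|x xD|u uD uX].
- by rewrite !value_lin (w1 x y) // (v1 x y).
- by rewrite value_lin w2 // v2 // mulr0 addr0.
- under eq_bigr do rewrite flux_lin.
  by rewrite big_split /= -mulr_sumr w3 // v3 // mulr0 addr0.
Qed.

Lemma eq_quasi X k w w' : w =1 w' -> quasi X k w -> quasi X k w'.
Proof. by move=> /funext->. Qed.

Lemma quasi0 X k : quasi X k (fun=> 0).
Proof.
split=> [x y _|x _|u _ _]; rewrite /value /wave ?mul0r ?addr0 //.
by rewrite big1 // => x _; rewrite /flux /dwave !mul0r subr0 mulr0.
Qed.

Lemma quasiZ X k c w : quasi X k w -> quasi X k (fun y => c * w y).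
Proof.
move=> qw; have := quasi_lin c qw (quasi0 X k).
by apply: eq_quasi => y; rewrite addr0.
Qed.

(** By the subtraction formulas the boundary Wronskian of an edge depends on the two frequencies
    only through their difference [d]. The sum vanishes at [d = 0], where its derivative in [d] is
    [dot w w'], defined below. *)
Definition wronskian_defect d w w' :=
  \sum_e (sin (d * edge_length e) *
            (w (e, false) * w' (e, false) + w (e, true) * w' (e, true)) +
          (cos (d * edge_length e) - 1) *
            (w (e, false) * w' (e, true) - w (e, true) * w' (e, false))).

Lemma sum_endpoints (f : endpoint -> R) :
  \sum_x f x = \sum_e (f (e, false) + f (e, true)).
Proof.
rewrite (eq_bigr (fun x => f (x.1, x.2))) => [|[]//].
rewrite -(pair_bigA _ (fun e b => f (e, b))) /=.
by apply: eq_bigr => e _; rewrite big_bool addrC.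
Qed.

Lemma wronskian_edges k k' w w' :
  \sum_x (value k w x * flux k' w' x - flux k w x * value k' w' x) =
  - wronskian_defect (k - k') w w'.
Proof.
rewrite sum_endpoints -sumrN; apply: eq_bigr => e _.
rewrite /value /flux /wave /dwave /= subrr !mulr0 cos0 sin0 -/(edge_length e).
by rewrite mulrBl sinB cosB; ring.
Qed.

(** A vertex outside [X] contributes nothing: at a Dirichlet vertex both values vanish, and
    elsewhere the common values factor out of flux sums that are zero by Kirchhoff's condition. *)
Lemma green X k k' w w' : quasi X k w -> quasi X k' w' ->
  \sum_(x | vtx x \in X) (value k w x * flux k' w' x - flux k w x * value k' w' x)
  = - wronskian_defect (k - k') w w'.
Proof.
move=> [w1 w2 w3] [v1 v2 v3]; rewrite -wronskian_edges.
rewrite [RHS](bigID (fun x => vtx x \in X)) /= -[LHS]addr0; congr (_ + _).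
apply/esym.
rewrite (partition_big (@vtx _ G) (fun u => u \notin X)) //=.
rewrite big1 // => u uX; have [y yu] := vtx_surj u.
have [uD|uD] := boolP (u \in D).
  apply: big1 => x /andP[_ /eqP xu].
  by rewrite w2 ?xu // v2 ?xu // mul0r mulr0 subr0.
rewrite (eq_bigl (fun x => vtx x == u)); last first.
  by move=> x /=; case: eqP => [->|]; rewrite ?uX ?andbF.
rewrite (eq_bigr (fun x => value k w y * flux k' w' x - value k' w' y * flux k w x)).
  by rewrite sumrB -!mulr_sumr v3 // w3 // !mulr0 subr0.
move=> x /eqP xu; rewrite (w1 x y) ?xu ?yu // (v1 x y) ?xu ?yu //; ring.
Qed.

End Waves.

(** * Eigenfunctions as waves, and absence of negative eigenvalues *)

Section Eigenwaves.
Context {R : realType} (G : metric_graph R) (D : {set vertex G}).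
Local Notation endpoint := (edge G * bool)%type.
Implicit Types (k : R) (w : endpoint -> R).

Lemma endpt_itv (e : edge G) b : endpt e b \in `[endpt e false, endpt e true].
Proof. by rewrite in_itv /=; case: b; rewrite lexx ltW // endpt_lt. Qed.

Lemma wave_eigenspace k w : quasi D finset.set0 k w -> eigenspace_of D (k ^+ 2) (wave k w).
Proof.
move=> [w1 w2 w3].
exists (fun e x => k * dwave k w e x), (fun e x => - k ^+ 2 * wave k w e x); split.
- by move=> e; apply: trig_sobolev2; exact: endpt_lt.
- by move=> e e' b b' /w1.
- by move=> e b /w2.
- move=> u uD; under eq_bigr do rewrite mulrCA.
  by rewrite -mulr_sumr [X in _ * X]w3 ?inE // mulr0.
- by move=> e; apply: aeW => x _; rewrite mulNr opprK.
Qed.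

Lemma eigenspace_wave k f : 0 < k -> eigenspace_of D (k ^+ 2) f ->
  exists2 w, quasi D finset.set0 k w & eq_on_graph f (wave k w).
Proof.
move=> k0 [p [g [sob cont dir kir ae]]].
pose w (x : endpoint) :=
  if x.2 then p x.1 (endpt x.1 false) / k else f x.1 (endpt x.1 false).
have fE e x : x \in `[endpt e false, endpt e true] ->
    f e x = wave k w e x /\ p e x = k * dwave k w e x.
  have [cf cp df dp] := sobolev2_ode (endpt_lt e) (sob e) (ae e).
  by apply: (ode_trig (endpt_lt e) (lt0r_neq0 k0) cf cp df dp).
have vE x : value k w x = f x.1 (endpt x.1 x.2).
  by rewrite (fE _ _ (endpt_itv _ _)).1.
exists w; last by move=> e x /fE[].
split.
- by move=> [e b] [e' b'] /cont; rewrite !vE.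
- by move=> [e b] /dir; rewrite vE.
- move=> u uD _; apply: (mulfI (lt0r_neq0 k0)); rewrite mulr0 mulr_sumr.
  rewrite -[RHS](kir u uD); apply: eq_bigr => x _.
  by rewrite (fE _ _ (endpt_itv _ _)).2 mulrCA.
Qed.

Lemma wave_eq0 k w : 0 < k -> eq_on_graph (wave k w) (fun _ _ => 0) -> forall x, w x = 0.
Proof.
move=> k0 w0.
have wf e : w (e, false) = 0.
  have := w0 e _ (endpt_itv e false).
  by rewrite /wave subrr mulr0 cos0 sin0 mulr1 mulr0 addr0.
move=> [e []]; last exact: wf.
(* At distance [t] from the start the angle [k * t] is positive and at most 1, hence below pi, so
   the sine does not vanish there. *)
pose t := Num.min (edge_length e) k^-1.
have t0 : 0 < t by rewrite lt_min edge_length_gt0 invr_gt0.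
have tl : t <= edge_length e by rewrite ge_min lexx.
have kt : k * t <= 1 by rewrite -(mulfV (lt0r_neq0 k0)) ler_pM2l // ge_min lexx orbT.
have := w0 e (endpt e false + t); rewrite in_itv /= lerDl ltW //=.
rewrite -lerBrDl tl => /(_ isT); rewrite /wave wf mul0r add0r addrC addKr.
move/eqP; rewrite mulf_eq0 => /orP[/eqP//|/eqP s0].
have : 0 < sin (k * t).
  apply: sin_gt0_pi; rewrite ?mulr_gt0 //.
  by apply: le_lt_trans kt _; apply: lt_le_trans (pi_ge2 R); rewrite ltr1n.
by rewrite s0 ltxx.
Qed.

(** The product of [f] and its derivative does not decrease along an edge, by [ode_neg], while the
    signed sum of its end values vanishes vertex by vertex. So it increases on no edge, and the
    equality case applies. *)
Lemma eigenspace_neg z f : z < 0 -> eigenspace_of D z f ->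
  eq_on_graph f (fun _ _ => 0).
Proof.
move=> z0 [p [g [sob cont dir kir ae]]].
pose B (x : endpoint) := f x.1 (endpt x.1 x.2) * p x.1 (endpt x.1 x.2).
have fz e : B (e, false) <= B (e, true) /\ (B (e, false) = B (e, true) ->
    {in `[endpt e false, endpt e true], forall x, f e x = 0}).
  have [cf cp df dp] := sobolev2_ode (endpt_lt e) (sob e) (ae e).
  exact: (ode_neg (endpt_lt e) z0 cf cp df dp).
have B0 : \sum_(x : endpoint) (-1) ^+ x.2 * B x = 0.
  rewrite (partition_big (@vtx _ G) predT) //= big1 // => u _.
  have [y yu] := vtx_surj u.
  have [uD|uD] := boolP (u \in D).
    apply: big1 => -[e b] /eqP xu; rewrite /B /= dir ?xu //.
    by rewrite mul0r mulr0.
  rewrite (eq_bigr (fun x : endpoint => f y.1 (endpt y.1 y.2) * ((-1) ^+ x.2 * p x.1 (endpt x.1 x.2)))).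
    by rewrite -mulr_sumr kir // mulr0.
  case: y yu => e' b' yu [e b] /eqP xu.
  by rewrite /B /= (cont e e' b b') ?xu ?yu // mulrCA.
have {}B0 : \sum_e (B (e, true) - B (e, false)) = 0.
  apply/eqP; rewrite -oppr_eq0 -sumrN -[X in _ == X]B0 sum_endpoints; apply/eqP.
  by apply: eq_bigr => e _ /=; rewrite expr0 expr1; ring.
move=> e x; apply: (fz e).2; apply/eqP; rewrite eq_sym -subr_eq0; apply/eqP.
have Bge0 e' : true -> 0 <= B (e', true) - B (e', false).
  by move=> _; rewrite subr_ge0; have [] := fz e'.
by move/eqP: B0; rewrite psumr_eq0 // => /allP/(_ e); rewrite mem_index_enum => /(_ isT)/eqP.
Qed.

Lemma has_dim_neg z : z < 0 -> has_dim (eigenspace_of D z) 0.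
Proof. by move=> z0; apply: has_dim0 => h; exact: eigenspace_neg. Qed.

Definition row_coef (r : 'rV[R]_#|{: endpoint}|) : endpoint -> R :=
  fun x => r 0 (enum_rank x).

Definition coef_row (w : endpoint -> R) : 'rV[R]_#|{: endpoint}| :=
  \row_i w (enum_val i).

Lemma coef_rowK w : row_coef (coef_row w) = w.
Proof. by apply/funext => x; rewrite /row_coef mxE enum_rankK. Qed.

Lemma row_coef_lin c a b :
  row_coef (c *: a + b) = (fun x => c * row_coef a x + row_coef b x).
Proof. by apply/funext => x; rewrite /row_coef !mxE. Qed.

Lemma row_coef_eq0 r : (forall x, row_coef r x = 0) -> r = 0.
Proof.
by move=> r0; apply/rowP => i; rewrite -(enum_valK i) [LHS]r0 mxE.
Qed.

End Eigenwaves.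

(** * Limits along ultrafilters *)

Section Ultra.
Context {R : realType}.

(** Reduces a statement about all points near a limit to convergence along ultrafilters. If [P]
    failed, [F] restricted to the complement of [P] would be proper, and an ultrafilter refining it
    would contain both [P] and its complement. *)
Lemma near_ultra (T : Type) (F : set_system T) (P : set T) : Filter F ->
  (forall H : set_system T, UltraFilter H -> F `<=` H -> H P) -> F P.
Proof.
move=> FF ultraP; apply: contrapT => nFP.
have wF : ProperFilter (within (~` P) F).
  apply: Build_ProperFilter_ex => B; rewrite /within /= => FB.
  apply: contrapT => nB; apply: nFP; apply: filterS FB => t tB.
  apply: contrapT => nP; apply: nB; exists t; exact: tB.
have [H [HU sub]] := ultraFilterLemma wF.
have HP : H P by apply: ultraP => // B FB; apply: sub; apply: filterS FB => t.
have HnP : H (~` P) by apply: sub; exact: withinT.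
have HI : H (P `&` ~` P) by exact: filterI.
by have [t []] := filter_ex HI.
Qed.

Lemma ultra_bounded_cvg (T : Type) (F : set_system T) (f : T -> R) (M : R) :
  UltraFilter F -> (\forall t \near F, `|f t| <= M) -> exists p : R, f @ F --> p.
Proof.
move=> FU fM.
have fF : (f @ F) [set` `[- M, M]] by apply: filterS fM => t; rewrite ler_norml /= in_itv.
have [p [_ clp]] := @segment_compact R (- M) M (f @ F) _ fF.
exists p => B pB.
have [//|nFB] := in_ultra_setVsetC (f @^-1` B) FU.
have [x [nBx Bx]] := clp (~` B) B nFB pB.
by case: (nBx Bx).
Qed.

End Ultra.

Lemma dnbhs_cvg (R : realType) (k : R) (F : set_system R) :
  k^' `<=` F -> (fun x : R => x) @ F --> k.
Proof. by move=> kF B /nbhs_dnbhs; exact: kF. Qed.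

Lemma cvg_cos_mul (R : realType) (k t : R) (F : set_system R) : Filter F ->
  k^' `<=` F -> (fun x => cos (x * t)) @ F --> cos (k * t).
Proof.
move=> FF kF; have h := dnbhs_cvg kF.
apply: (@continuous_cvg _ _ _ _ _ _ (cos : R -> R)); first exact: continuous_cos.
by apply: cvgM => //; exact: cvg_cst.
Qed.

Lemma cvg_sin_mul (R : realType) (k t : R) (F : set_system R) : Filter F ->
  k^' `<=` F -> (fun x => sin (x * t)) @ F --> sin (k * t).
Proof.
move=> FF kF; have h := dnbhs_cvg kF.
apply: (@continuous_cvg _ _ _ _ _ _ (sin : R -> R)); first exact: continuous_sin.
by apply: cvgM => //; exact: cvg_cst.
Qed.

Lemma cvg_slope (R : realType) (f : R -> R) (k df : R) (F : set_system R) :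
  Filter F -> k^' `<=` F -> is_derive k 1 f df ->
  (fun x => (f x - f k) / (x - k)) @ F --> df.
Proof.
move=> FF kF [dv <-].
pose g (h : R) := h^-1 *: ((f \o shift k) (h *: (1 : R)) - f k).
have -> : (fun x => (f x - f k) / (x - k)) = g \o (fun x => x - k).
  apply/funext => x; rewrite /g /= /GRing.scale /= mulr1 subrK.
  by rewrite mulrC.
apply: (@cvg_comp _ _ _ (fun x => x - k) g F 0^'); last exact: dv.
move=> B [e /= e0 eB]; apply: kF; exists e => //= x /= xe xk.
apply: eB; last by rewrite subr_eq0.
by rewrite /= sub0r normrN distrC.
Qed.

Lemma cvg_big_sum (R : realType) (T : Type) (F : set_system T) (I : Type)
    (s : seq I) (f : I -> T -> R) (l : I -> R) : Filter F ->
  (forall i, f i @ F --> l i) ->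
  (fun t => \sum_(i <- s) f i t) @ F --> \sum_(i <- s) l i.
Proof.
move=> FF fl; elim: s => [|i s IH].
  rewrite big_nil (_ : (fun _ => _) = cst 0); first exact: cvg_cst.
  by apply/funext => t; rewrite big_nil.
rewrite big_cons (_ : (fun _ => _) = (fun t => f i t + \sum_(j <- s) f j t)).
  exact: cvgD.
by apply/funext => t; rewrite big_cons.
Qed.

Lemma cvg_near_eq (R : realType) (T : Type) (F : set_system T) (f g : T -> R) (l : R) :
  Filter F -> (\forall t \near F, f t = g t) -> f @ F --> l -> g @ F --> l.
Proof.
move=> FF fg fl B lB; have := fl B lB.
by apply: filterS2 fg => t /= ->.
Qed.

(** * Unit waves with [v] left free, and their limits *)

Section WeylVectors.
Context {R : realType} (G : metric_graph R) (D : {set vertex G}).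
Local Notation endpoint := (edge G * bool)%type.
Implicit Types (k : R) (w : endpoint -> R).
Variables (v : vertex G) (x0 : endpoint).
Hypotheses (x0v : vtx x0 = v) (x0_only : forall x, vtx x = v -> x = x0).
Hypothesis vD : v \notin D.
Local Notation q := (quasi D [set v]%SET).
Local Notation eig := (quasi D finset.set0).

(** The first-order coefficient of [wronskian_defect] at [d = 0]. Being positive definite, it also
    provides the norm in which waves are made unit. *)
Definition dot w w' : R := \sum_e edge_length e *
  (w (e, false) * w' (e, false) + w (e, true) * w' (e, true)).

Lemma dot_linl c w w' u : dot (fun x => c * w x + w' x) u = c * dot w u + dot w' u.
Proof.
rewrite /dot mulr_sumr -big_split /=; apply: eq_bigr => e _; ring.
Qed.

Lemma dotZl c w u : dot (fun x => c * w x) u = c * dot w u.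
Proof. by rewrite /dot mulr_sumr; apply: eq_bigr => e _; ring. Qed.

Lemma dotC w w' : dot w w' = dot w' w.
Proof. by apply: eq_bigr => e _; ring. Qed.

Lemma dot_ge0 w : 0 <= dot w w.
Proof.
apply: sumr_ge0 => e _; apply: mulr_ge0; first exact: ltW (edge_length_gt0 e).
by rewrite -!expr2 addr_ge0 ?sqr_ge0.
Qed.

Lemma dot_eq0 w : dot w w = 0 -> forall x, w x = 0.
Proof.
move=> /eqP; rewrite psumr_eq0 => [/allP h [e b]|e _]; last first.
  apply: mulr_ge0; first exact: ltW (edge_length_gt0 e).
  by rewrite -!expr2 addr_ge0 ?sqr_ge0.
have := h e; rewrite mem_index_enum => /(_ isT).
rewrite mulf_eq0 (gt_eqF (edge_length_gt0 e)) /= -!expr2.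
rewrite paddr_eq0 ?sqr_ge0 // !sqrf_eq0 => /andP[/eqP hf /eqP ht].
by case: b.
Qed.

(** The bound is independent of the frequency, so unit waves stay in a compact set as [k] varies. *)
Lemma dot1_bound w x : dot w w = 1 -> `|w x| <= 1 + (edge_length x.1)^-1.
Proof.
case: x => e b w1 /=; have l0 := edge_length_gt0 e.
have : edge_length e * (w (e, b) ^+ 2) <= 1.
  rewrite -w1 /dot (bigD1 e) //= -[X in X <= _]addr0; apply: lerD.
    rewrite ler_pM2l // -!expr2.
    by case: (b); rewrite ?lerDl ?lerDr ?sqr_ge0.
  apply: sumr_ge0 => e' _; apply: mulr_ge0; first exact: ltW (edge_length_gt0 e').
  by rewrite -!expr2 addr_ge0 ?sqr_ge0.
rewrite mulrC -ler_pdivlMr // div1r => h.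
have h2 : `|w (e, b)| ^+ 2 <= (edge_length e)^-1 by rewrite real_normK ?num_real.
have := sqr_ge0 (`|w (e, b)| - 1); have := normr_ge0 (w (e, b)); nra.
Qed.

Lemma green1 k k' w w' : q k w -> q k' w' ->
  value k w x0 * flux k' w' x0 - flux k w x0 * value k' w' x0 =
  - wronskian_defect (k - k') w w'.
Proof.
move=> qw qw'; rewrite -(green qw qw') (eq_bigl (pred1 x0)) ?big_pred1_eq //.
move=> x /=; rewrite finset.in_set1; apply/eqP/eqP => [/x0_only//|->]; exact: x0v.
Qed.

Lemma quasi_eig k w : eig k w <-> q k w /\ flux k w x0 = 0.
Proof.
have fl : \sum_(x | vtx x == v) flux k w x = flux k w x0.
  rewrite (eq_bigl (pred1 x0)) ?big_pred1_eq // => x /=.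
  by apply/eqP/eqP => [/x0_only//|->].
split=> [[w1 w2 w3]|[[w1 w2 w3] f0]]; split=> //.
- by split=> // u uD _; apply: w3; rewrite ?inE.
- by rewrite -fl w3 ?inE.
- move=> u uD _; have [->|uv] := eqVneq u v; first by rewrite fl.
  by apply: w3; rewrite ?finset.in_set1.
Qed.

(** There is one equation for each endpoint other than [x0], hence one fewer than unknowns. An
    endpoint that is not the representative of its vertex gives continuity with the representative;
    a representative gives the Dirichlet or Kirchhoff condition. At [v] the only endpoint is [x0],
    so nothing is imposed. *)
Lemma quasi_space k : exists2 U : 'M[R]_#|{: endpoint}|,
  (forall r, (r <= U)%MS <-> q k (row_coef r)) & (0 < \rank U)%N.
Proof.
pose rep (u : vertex G) := sval (cid (vtx_surj u)).
have repE u : vtx (rep u) = u by rewrite /rep; case: cid.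
have repv : rep v = x0 by apply: x0_only.
pose Q (x : {x : endpoint | x != x0}) r : R := let w := row_coef r in
  if val x != rep (vtx (val x)) then value k w (val x) - value k w (rep (vtx (val x)))
  else if vtx (val x) \in D then value k w (val x)
  else \sum_(y | vtx y == vtx (val x)) flux k w y.
have Qlin i c a b : Q i (c *: a + b) = c * Q i a + Q i b.
  rewrite /Q row_coef_lin; case: ifP => _; first by rewrite !value_lin; ring.
  case: ifP => _; first exact: value_lin.
  by under eq_bigr do rewrite flux_lin; rewrite big_split /= -mulr_sumr.
have [U UE rk] := solution_space Qlin.
exists U; last first.
  have c1 : #|[pred x : endpoint | x != x0]| = #|{: endpoint}|.-1 := cardC1 x0.
  move: rk; rewrite card_sig c1; have : (0 < #|{: endpoint}|)%N by apply/card_gt0P; exists x0.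
  lia.
move=> r; split=> [/UE Q0|[w1 w2 w3]]; last first.
  apply/UE => -[x xx0]; rewrite /Q /=; case: ifP => [_|/negbFE/eqP xr].
    by rewrite (w1 x (rep (vtx x))) ?subrr // repE.
  case: ifP => [/w2//|/negbT xD]; apply: w3 => //; rewrite finset.in_set1.
  by apply: contraNneq xx0 => /x0_only ->.
have {}Q0 y (h : y != x0) : Q (exist (fun y => is_true (y != x0)) y h) r = 0.
  exact: Q0.
have vrep x : value k (row_coef r) x = value k (row_coef r) (rep (vtx x)).
  have [xr|xr] := eqVneq x (rep (vtx x)); first by rewrite -xr.
  have xx0 : x != x0 by apply: contraNneq xr => ->; rewrite x0v repv.
  have := Q0 _ xx0; rewrite /Q /= xr => /eqP.
  by rewrite subr_eq0 => /eqP.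
split.
- by move=> x y xy; rewrite vrep (vrep y) xy.
- move=> x xD; rewrite vrep.
  have xx0 : rep (vtx x) != x0.
    by apply: contraTneq xD => rx; rewrite -(repE (vtx x)) rx x0v.
  by have := Q0 _ xx0; rewrite /Q /= repE eqxx /= xD.
- move=> u uD; rewrite finset.in_set1 => uv.
  have xx0 : rep u != x0 by apply: contraNneq uv => ru; rewrite -x0v -ru repE.
  by have := Q0 _ xx0; rewrite /Q /= repE eqxx /= (negbTE uD).
Qed.

Lemma unit_multiple X k w : quasi D X k w -> (exists x, w x != 0) ->
  exists2 c, quasi D X k (fun x => c * w x) &
    dot (fun x => c * w x) (fun x => c * w x) = 1.
Proof.
move=> qw [x wx]; have d0 : 0 < dot w w.
  by rewrite lt_neqAle dot_ge0 andbT eq_sym; apply: contraNneq wx => /dot_eq0 ->.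
exists (Num.sqrt (dot w w))^-1; first exact: quasiZ.
have -> c : dot (fun x => c * w x) (fun x => c * w x) = c ^+ 2 * dot w w.
  by rewrite /dot mulr_sumr; apply: eq_bigr => e _; ring.
by rewrite exprVn sqr_sqrtr ?ltW // mulVf // gt_eqF.
Qed.

Lemma quasi_unit k : exists2 w, q k w & dot w w = 1.
Proof.
have [U UE rk] := quasi_space k.
have /rowV0Pn[r rU r0] : U != 0 by rewrite -mxrank_eq0 -lt0n.
have [||c qc dc] := @unit_multiple [set v]%SET k (row_coef r).
- exact/UE.
- apply: contrapT => nx; case/negP: r0; apply/eqP/row_coef_eq0 => x.
  by apply/eqP; apply: contrapT => /negP wx; apply: nx; exists x.
- by exists (fun x => c * row_coef r x).
Qed.

(** Bounded coefficients converge along the ultrafilter; values and fluxes are jointly continuous in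
    the frequency and the coefficients, so the vertex conditions pass to the limit. *)
Lemma quasi_limit X k (F : set_system R) (W : R -> endpoint -> R) :
  UltraFilter F -> k^' `<=` F ->
  (\forall t \near F, quasi D X t (W t) /\ dot (W t) (W t) = 1) ->
  exists w, [/\ forall x, W ^~ x @ F --> w x,
    forall x, (fun t => value t (W t) x) @ F --> value k w x,
    forall x, (fun t => flux t (W t) x) @ F --> flux k w x,
    quasi D X k w & dot w w = 1].
Proof.
move=> FU kF qW.
have bnd x : \forall t \near F, `|W t x| <= 1 + (edge_length x.1)^-1.
  by apply: filterS qW => t [_]; exact: dot1_bound.
have /choice[w wE] x : exists p : R, W ^~ x @ F --> p.
  exact: ultra_bounded_cvg (bnd x).
have vE x : (fun t => value t (W t) x) @ F --> value k w x.
  by apply: cvgD; apply: cvgM => //; [exact: cvg_cos_mul|exact: cvg_sin_mul].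
have fE x : (fun t => flux t (W t) x) @ F --> flux k w x.
  apply: cvgM; first exact: cvg_cst.
  by apply: cvgB; apply: cvgM => //; [exact: cvg_cos_mul|exact: cvg_sin_mul].
have uniq (f : R -> R) (a b : R) : f @ F --> a -> (\forall t \near F, f t = b) -> a = b.
  move=> fa fb; apply: (@norm_cvg_unique _ _ (f @ F)) => //.
  apply: (cvg_near_eq (f := fun=> b)); last exact: cvg_cst.
  by apply: filterS fb => t ->.
exists w; split=> //; first split.
- move=> x y xy; apply/eqP; rewrite -subr_eq0; apply/eqP.
  apply: uniq (cvgB (vE x) (vE y)) _; apply: filterS qW => t [[w1 _ _] _] /=.
  by rewrite /GRing.add /= /GRing.opp /= (w1 x y xy) subrr.
- move=> x xD; apply: uniq (vE x) _; apply: filterS qW => t [[_ w2 _] _].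
  exact: w2.
- move=> u uD uX; rewrite -big_filter.
  apply: uniq (cvg_big_sum _ (fun x => fE x)) _; apply: filterS qW => t [[_ _ w3] _].
  by rewrite big_filter; exact: w3.
- have h : (fun t => dot (W t) (W t)) @ F --> dot w w.
    apply: cvg_big_sum => e; apply: cvgMr.
    by apply: cvgD; apply: cvgM; exact: wE.
  by apply: uniq h _; apply: filterS qW => t [].
Qed.

(** Green's identity divided by [t - k]. The slopes at [k] of [sin (edge_length e * (t - k))] and of
    the corresponding cosine tend to [edge_length e] and 0, which leaves [dot u w]. *)
Lemma green_limit k (F : set_system R) (W : R -> endpoint -> R) w u :
  UltraFilter F -> k^' `<=` F ->
  (\forall t \near F, q t (W t)) -> (forall x, W ^~ x @ F --> w x) -> q k u ->
  (fun t => (value k u x0 * flux t (W t) x0 - flux k u x0 * value t (W t) x0) /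
            (t - k)) @ F --> dot u w.
Proof.
move=> FU kF qW Ww qu.
have dsin (e : edge G) : (fun t => (sin (edge_length e * (t - k)) - sin (edge_length e * (k - k))) /
    (t - k)) @ F --> edge_length e.
  apply: (cvg_slope (f := fun t => sin (edge_length e * (t - k)))) => //.
  have := is_derive_sin_affine (edge_length e) k k.
  by rewrite subrr mulr0 cos0 mulr1.
have dcos (e : edge G) : (fun t => (cos (edge_length e * (t - k)) - cos (edge_length e * (k - k))) /
    (t - k)) @ F --> 0.
  apply: (cvg_slope (f := fun t => cos (edge_length e * (t - k)))) => //.
  have := is_derive_cos_affine (edge_length e) k k.
  by rewrite subrr mulr0 sin0 mulr0 oppr0.
pose a (e : edge G) t := (sin (edge_length e * (t - k)) - sin (edge_length e * (k - k))) / (t - k).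
pose b (e : edge G) t := (cos (edge_length e * (t - k)) - cos (edge_length e * (k - k))) / (t - k).
have h : (fun t => \sum_e (a e t * (u (e, false) * W t (e, false) +
      u (e, true) * W t (e, true)) -
    b e t * (u (e, false) * W t (e, true) - u (e, true) * W t (e, false)))) @ F
    --> \sum_e (edge_length e * (u (e, false) * w (e, false) + u (e, true) * w (e, true)) -
    0 * (u (e, false) * w (e, true) - u (e, true) * w (e, false))).
  apply: cvg_big_sum => e; apply: cvgB; apply: cvgM.
  - exact: dsin.
  - by apply: cvgD; apply: cvgMr; exact: Ww.
  - exact: dcos.
  - by apply: cvgB; apply: cvgMr; exact: Ww.
have -> : dot u w = \sum_e (edge_length e * (u (e, false) * w (e, false) +
      u (e, true) * w (e, true)) -
    0 * (u (e, false) * w (e, true) - u (e, true) * w (e, false))).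
  by apply: eq_bigr => e _; rewrite mul0r subr0.
apply: cvg_near_eq h; apply: filterS qW => t qt.
rewrite (green1 qu qt) -sumrN mulr_suml; apply: eq_bigr => e _.
rewrite /a /b subrr mulr0 sin0 cos0.
rewrite (_ : (k - t) * edge_length e = - (edge_length e * (t - k))); last by ring.
by rewrite sinN cosN; ring.
Qed.

End WeylVectors.

(** * The trace at the vertex v *)

(** Strict decrease seen from the point [k] alone, without a derivative; this form is stable under
    sums and strong enough for [zero_unique]. *)
Definition regular_at (R : realType) (r : R -> R) (k : R) :=
  {for k, continuous r} /\ \forall t \near k^', (r t - r k) * (t - k) < 0.

(** The function lies above [c / (t - k)] to the right of [k] and below it to the left, the
    orientation that fits decrease between poles. *)
Definition pole_at (R : realType) (r : R -> R) (k : R) :=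
  exists2 c : R, 0 < c & \forall t \near k^', c < r t * (t - k).

Lemma cvg_lt (R : realType) (T : Type) (F : set_system T) (f : T -> R) (a l : R)
    {FF : Filter F} : a < l -> f @ F --> l -> \forall t \near F, a < f t.
Proof. by move=> al fl; exact: (fl _ (lt_nbhsr al)). Qed.

Lemma cvg_scale (R : realType) (T : Type) (F : set_system T) (f : T -> R) (c l : R)
    {FF : Filter F} : f @ F --> l -> (fun t => c * f t) @ F --> c * l.
Proof. exact: cvgMr. Qed.

(** * Quotients of a pair known only up to sign *)

Section TracePair.
Context {R : realType} (f g : R -> R) (k s : R).
Hypotheses (s0 : 0 < s) (fg0 : (f k != 0) || (g k != 0)).
(** The sign [c] may depend on the ultrafilter, because the generators are chosen independently at
    each frequency. *)
Hypothesis lim : forall F : set_system R, UltraFilter F -> k^' `<=` F ->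
  exists c : R, [/\ c ^+ 2 = 1, f @ F --> c * f k, g @ F --> c * g k &
        (fun t => (f k * g t - g k * f t) / (t - k)) @ F --> c * s].

(** The sign cancels in [f t / g t] and in products such as [c * g k * g t]. The slope of the
    quotient is minus the Wronskian quotient over [g k * g t], and the product of these two factors
    tends to [s * g k ^+ 2 > 0]. *)
Lemma trace_pair_regular : g k != 0 ->
  regular_at (fun t => f t / g t) k /\ \forall t \near k^', g t != 0.
Proof.
move=> gk0.
have gk2 : 0 < g k ^+ 2 by rewrite lt_neqAle sqr_ge0 andbT eq_sym sqrf_eq0.
have gn0 : \forall t \near k^', g t != 0.
  apply: near_ultra => F FU kF; have [c [c2 _ gc _]] := lim FU kF.
  have h : (fun t => c * g k * g t) @ F --> g k ^+ 2.
    rewrite (_ : g k ^+ 2 = c * g k * (c * g k)); first exact: cvg_scale.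
    by rewrite -[LHS]mul1r -c2; ring.
  apply: filterS (cvg_lt gk2 h) => t; apply: contraTneq => ->.
  by rewrite mulr0 ltxx.
split=> //; split.
  move=> B rB; rewrite dnbhsE; split; last by apply/principal_filterP; exact: nbhs_singleton rB.
  apply: near_ultra => F FU kF; have [c [c2 fc gc _]] := lim FU kF.
  have c0 : c != 0 by rewrite -sqrf_eq0 c2 oner_eq0.
  have h : (fun t => f t / g t) @ F --> f k / g k.
    rewrite (_ : f k / g k = c * f k / (c * g k)); last by field; rewrite c0 gk0.
    by apply: cvgM => //; apply: cvgV => //; exact: mulf_neq0.
  exact: h.
apply: near_ultra => F FU kF; have [c [c2 _ gc yc]] := lim FU kF.
have h : (fun t => (f k * g t - g k * f t) / (t - k) * (g k * g t)) @ F --> s * g k ^+ 2.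
  rewrite (_ : s * g k ^+ 2 = c * s * (g k * (c * g k))); last by rewrite -[LHS]mul1r -c2; ring.
  by apply: cvgM => //; exact: cvg_scale.
have tk : \forall t \near F, t != k by exact: (kF _ (nbhs_dnbhs_neq k)).
have gF : \forall t \near F, g t != 0 by exact: kF.
apply: filterS3 tk gF (cvg_lt (mulr_gt0 s0 gk2) h) => t tk gt0 /= pos.
have tk0 : t - k != 0 by rewrite subr_eq0.
rewrite (_ : _ * _ = - ((f k * g t - g k * f t) / (t - k) * (g k * g t)) *
  ((t - k) / (g k * g t)) ^+ 2); last by field; rewrite tk0 gk0 gt0.
rewrite mulNr oppr_lt0 mulr_gt0 // lt_neqAle sqr_ge0 andbT eq_sym sqrf_eq0.
by rewrite mulf_neq0 // invr_neq0 // mulf_neq0.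
Qed.

Lemma trace_pair_pole : g k = 0 ->
  pole_at (fun t => f t / g t) k /\ \forall t \near k^', g t != 0.
Proof.
move=> gk0; have := fg0; rewrite gk0 eqxx orbF => fk0.
have fk2 : 0 < f k ^+ 2 by rewrite lt_neqAle sqr_ge0 andbT eq_sym sqrf_eq0.
have gn0 : \forall t \near k^', g t != 0.
  apply: near_ultra => F FU kF; have [c [c2 _ _ yc]] := lim FU kF.
  have h : (fun t => c * ((f k * g t - g k * f t) / (t - k))) @ F --> s.
    by rewrite -[s]mul1r -c2 expr2 -mulrA; exact: cvg_scale.
  apply: filterS (cvg_lt s0 h) => t; apply: contraTneq => ->.
  by rewrite gk0 mulr0 !mul0r subr0 mul0r mulr0 ltxx.
(* Half the limit of [f t / g t * (t - k)]: since [g k = 0], this is [f k * f t] over the Wronskian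
   quotient, and the sign cancels. *)
split=> //; exists (f k ^+ 2 / s / 2); first by rewrite !divr_gt0.
apply: near_ultra => F FU kF; have [c [c2 fc _ yc]] := lim FU kF.
have c0 : c != 0 by rewrite -sqrf_eq0 c2 oner_eq0.
have h : (fun t => f k * f t / ((f k * g t - g k * f t) / (t - k))) @ F --> f k ^+ 2 / s.
  rewrite (_ : f k ^+ 2 / s = f k * (c * f k) / (c * s)); last first.
    by field; rewrite c0 gt_eqF.
  apply: cvgM; first exact: cvg_scale.
  by apply: cvgV => //; rewrite mulf_neq0 // gt_eqF.
have lt2 : f k ^+ 2 / s / 2 < f k ^+ 2 / s.
  by rewrite ltr_pdivrMr // ltr_pMr ?divr_gt0 // ltr1n.
have tk : \forall t \near F, t != k by exact: (kF _ (nbhs_dnbhs_neq k)).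
have gF : \forall t \near F, g t != 0 by exact: kF.
apply: filterS3 tk gF (cvg_lt lt2 h) => t tk gt0 /=.
have tk0 : t - k != 0 by rewrite subr_eq0.
rewrite gk0 mul0r subr0 => hlt; apply: (lt_le_trans hlt).
by rewrite le_eqVlt; apply/orP; left; apply/eqP; field; rewrite tk0 fk0 gt0.
Qed.

End TracePair.

(** * The line of traces at [v] and its quotient *)

Section Weyl.
Context {R : realType} (G : metric_graph R) (D : {set vertex G}).
Local Notation endpoint := (edge G * bool)%type.
Implicit Types (k : R) (w : endpoint -> R).
Variables (v : vertex G) (x0 : endpoint).
Hypotheses (x0v : vtx x0 = v) (x0_only : forall x, vtx x = v -> x = x0).
Hypothesis vD : v \notin D.
Local Notation q := (quasi D [set v]%SET).
Local Notation eig := (quasi D finset.set0).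

(** Unit eigenwaves accumulating at [k] would have a unit eigenwave [w] at [k] as a limit. All
    fluxes at [v] vanish, so the Green quotient is 0, whereas its limit is [dot w w = 1]. *)
Lemma eig_isolated k : \forall t \near k^', forall w, eig t w -> forall x, w x = 0.
Proof.
apply: near_ultra => F FU kF.
have [//|nF] := in_ultra_setVsetC [set t : R | forall w, eig t w -> forall x, w x = 0] FU.
have /choice[W WE] (t : R) : exists w, ~ (forall w, eig t w -> forall x, w x = 0) ->
    eig t w /\ dot w w = 1.
  have [h|h] := pselect (forall w, eig t w -> forall x, w x = 0).
    by exists (fun=> 0).
  have /existsNP[w /not_implyP[ew /existsNP[x wx]]] := h.
  have wx' : exists x, w x != 0 by exists x; apply/eqP.
  by have [c qc dc] := unit_multiple ew wx'; exists (fun x => c * w x).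
have eW : \forall t \near F, eig t (W t) /\ dot (W t) (W t) = 1.
  by apply: filterS nF => t /WE.
have [w [Ww vw fw ew dw]] := quasi_limit FU kF eW.
have [qw f0] := (quasi_eig x0v x0_only vD _ _).1 ew.
have qW : \forall t \near F, q t (W t).
  by apply: filterS eW => t [] /(quasi_eig x0v x0_only vD)[].
have h := green_limit x0v x0_only FU kF qW Ww qw.
have : 1 = 0 :> R; last by move=> /eqP; rewrite oner_eq0.
rewrite -dw; apply: (norm_cvg_unique h).
apply: (cvg_near_eq (f := fun=> 0)); last exact: cvg_cst.
apply: filterS eW => t [] /(quasi_eig x0v x0_only vD)[_ ft0] _.
by rewrite f0 ft0 mulr0 mul0r subr0 mul0r.
Qed.

(* A limit of unit waves at frequencies tending to [k]: Green's identity makes it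
   orthogonal to the waves at [k] with zero trace, so its own trace is nonzero. *)
Lemma normal_vector k : exists w, [/\ q k w, dot w w = 1 &
  forall h, q k h -> value k h x0 = 0 -> flux k h x0 = 0 -> dot h w = 0].
Proof.
have [F [FU kF]] := ultraFilterLemma (Proper_dnbhs_numFieldType k).
have /choice[W WE] (t : R) : exists w, q t w /\ dot w w = 1.
  by have [w] := quasi_unit x0v x0_only vD t; exists w.
have eW : \forall t \near F, q t (W t) /\ dot (W t) (W t) = 1.
  exact: nearW.
have [w [Ww vw fw qw dw]] := quasi_limit FU kF eW.
exists w; split=> // h qh v0 f0.
have qW : \forall t \near F, q t (W t) by apply: filterS eW => t [].
have hl := green_limit x0v x0_only FU kF qW Ww qh.
apply: (norm_cvg_unique hl).
apply: (cvg_near_eq (f := fun=> 0)); last exact: cvg_cst.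
by apply: nearW => t; rewrite v0 f0 !mul0r subr0 mul0r.
Qed.

(** At equal frequencies the Wronskian defect vanishes, so the traces are isotropic in the plane and
    span at most a line. *)
Lemma trace_isotropic k w w' : q k w -> q k w' ->
  value k w x0 * flux k w' x0 = flux k w x0 * value k w' x0.
Proof.
move=> qw qw'; apply/eqP; rewrite -subr_eq0 (green1 x0v x0_only qw qw').
rewrite oppr_eq0 /wronskian_defect big1 // => e _.
by rewrite subrr mul0r sin0 cos0 subrr !mul0r addr0.
Qed.

(** [(f k, g k)] is the trace of a normal vector [W k]. It is nonzero: otherwise [W k] would be a
    wave of zero trace, hence orthogonal to itself. *)
Lemma weyl_function : exists f g : R -> R,
  [/\ forall k, (f k != 0) || (g k != 0),
      forall k, exists w, [/\ q k w, value k w x0 = f k & flux k w x0 = g k],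
      forall k w, q k w -> exists c, value k w x0 = c * f k /\ flux k w x0 = c * g k,
      forall k, g k != 0 -> regular_at (fun t => f t / g t) k /\
                            \forall t \near k^', g t != 0 &
      forall k, g k = 0 -> pole_at (fun t => f t / g t) k /\
                            \forall t \near k^', g t != 0].
Proof.
have /choice[W WE] := normal_vector.
pose f k := value k (W k) x0; pose g k := flux k (W k) x0.
have fg k : (f k != 0) || (g k != 0).
  have [qW dW oW] := WE k; rewrite -negb_and; apply/negP => /andP[/eqP f0 /eqP g0].
  by have /eqP := oW _ qW f0 g0; rewrite dW oner_eq0.
have line k w : q k w -> exists c, value k w x0 = c * f k /\ flux k w x0 = c * g k.
  move=> qw; have [qW _ _] := WE k; have iso := trace_isotropic qw qW.
  have [g0|g0] := eqVneq (g k) 0.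
    have := fg k; rewrite g0 eqxx orbF => f0.
    exists (value k w x0 / f k); split; first by rewrite divfK.
    move: iso; rewrite -/(f k) -/(g k) g0 mulr0 mulr0 => /esym/eqP.
    by rewrite mulf_eq0 (negbTE f0) orbF => /eqP.
  exists (flux k w x0 / g k); split; last by rewrite divfK.
  by rewrite mulrAC -iso -/(g k) mulfK.
have lim k (F : set_system R) : UltraFilter F -> k^' `<=` F -> exists c : R,
    [/\ c ^+ 2 = 1, f @ F --> c * f k, g @ F --> c * g k &
        (fun t => (f k * g t - g k * f t) / (t - k)) @ F --> c].
  move=> FU kF; have [qWk dWk oWk] := WE k.
  have eW : \forall t \near F, q t (W t) /\ dot (W t) (W t) = 1.
    by apply: nearW => t; have [] := WE t.
  have qW : \forall t \near F, q t (W t) by apply: filterS eW => t [].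
  have [w [Ww vw fw qw dw]] := quasi_limit FU kF eW.
  have [c [vc fc]] := line k w qw.
  (* This difference has zero trace, so it is orthogonal to [w] by the Green limit and to [W k] by
     the choice of [W k], hence to itself. Thus [w] is [c] times [W k], and both being unit gives
     [c ^+ 2 = 1]. *)
  pose h x := - c * W k x + w x.
  have qh : q k h by exact: quasi_lin.
  have vh : value k h x0 = 0 by rewrite value_lin vc -/(f k); ring.
  have fh : flux k h x0 = 0 by rewrite flux_lin fc -/(g k); ring.
  have hw : dot h w = 0.
    apply: (norm_cvg_unique (green_limit x0v x0_only FU kF qW Ww qh)).
    apply: (cvg_near_eq (f := fun=> 0)); last exact: cvg_cst.
    by apply: nearW => t; rewrite vh fh !mul0r subr0 mul0r.
  have hW := oWk h qh vh fh.
  have hh : dot h h = 0 by rewrite dot_linl dotC hW (dotC w) hw mulr0 addr0.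
  have wc : w = fun x => c * W k x.
    apply/funext => x; have := dot_eq0 hh x.
    by rewrite /h mulNr addrC => /subr0_eq.
  have dc : dot (W k) w = c.
    by rewrite dotC wc dotZl dWk mulr1.
  exists c; split.
  - by rewrite -[RHS]dw [in dot w w]wc dotZl -wc dc.
  - by rewrite -vc; exact: vw.
  - by rewrite -fc; exact: fw.
  - by rewrite -dc; exact: (green_limit x0v x0_only FU kF qW Ww qWk).
have lim' k (F : set_system R) : UltraFilter F -> k^' `<=` F -> exists c : R,
    [/\ c ^+ 2 = 1, f @ F --> c * f k, g @ F --> c * g k &
        (fun t => (f k * g t - g k * f t) / (t - k)) @ F --> c * 1].
  by move=> FU kF; have [c cE] := lim k F FU kF; exists c; rewrite mulr1.
exists f, g; split=> //.
- by move=> k; exists (W k); have [] := WE k.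
- by move=> k; exact: (trace_pair_regular ltr01 (lim' k)).
- by move=> k; exact: (trace_pair_pole ltr01 (fg k) (lim' k)).
Qed.

End Weyl.

(** * Interlacing of zeros and poles *)

(** By Bolzano-Weierstrass, infinitely many points in the segment would accumulate somewhere,
    against isolation. *)
Lemma isolated_segment_seq (R : realType) (S : set R) (a b : R) :
  (forall k : R, \forall t \near k^', ~ S t) ->
  exists2 s : seq R, uniq s & forall x, x \in s <-> S x /\ a <= x <= b.
Proof.
move=> iso; pose E : set R := [set x | S x /\ a <= x <= b].
have /finite_seqP[s sE] : finite_set E.
  apply: contrapT => infE.
  have bE : bounded_set E.
    exists (Num.max `|a| `|b|); split; first exact: num_real.
    move=> M ltM x [_ /andP[ax xb]] /=; rewrite ler_norml.
    move: ltM; rewrite gt_max !ltr_norml => /andP[/andP[? ?] /andP[? ?]].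
    by apply/andP; split; lra.
  have [p lp] := infinite_bounded_limit_point_nonempty infE bE.
  have [y [yp [Sy _] nSy]] := lp _ (iso p).
  exact: nSy.
exists (undup s); first exact: undup_uniq.
move=> x; rewrite mem_undup.
by rewrite -[S x /\ _]/(E x) sE.
Qed.

Lemma seq_max_exists (R : realType) (s : seq R) (x : R) : x \in s ->
  exists2 m, m \in s & {in s, forall y, y <= m}.
Proof.
elim: s x => // a s IH x _; case: s IH => [_|b s IH].
  by exists a; rewrite ?mem_head // => y; rewrite inE => /eqP->.
have [m ms mm] := IH b (mem_head _ _).
have [ma|am] := leP m a.
  exists a; first exact: mem_head.
  move=> y; rewrite inE => /predU1P[->//|ys]; exact: le_trans (mm y ys) ma.
exists m; first by rewrite inE ms orbT.
by move=> y; rewrite inE => /predU1P[->|/mm//]; exact: ltW.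
Qed.

Lemma seq_min_exists (R : realType) (s : seq R) (x : R) : x \in s ->
  exists2 m, m \in s & {in s, forall y, m <= y}.
Proof.
move=> xs; have xs' : - x \in [seq - y | y <- s] by exact: map_f.
have [m /mapP[y ys ->] h] := seq_max_exists xs'; exists y => // z zs.
by rewrite -lerN2; apply: h; exact: map_f.
Qed.

Section Antitone.
Context {R : realType}.
Implicit Types (r F : R -> R) (k : R).

Lemma cvg_sub_dnbhs k : (fun t => t - k) @ k^' --> (0 : R).
Proof.
rewrite -[X in _ --> X](subrr k); apply: cvgB; last exact: cvg_cst.
by move=> B /nbhs_dnbhs.
Qed.

Lemma regularD r1 r2 k : regular_at r1 k -> regular_at r2 k ->
  regular_at (fun t => r1 t + r2 t) k.
Proof.
move=> [c1 d1] [c2 d2]; split; first exact: cvgD.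
apply: filterS2 d1 d2 => t h1 h2.
by rewrite opprD addrACA mulrDl -[ltRHS]addr0 ltrD.
Qed.

Lemma pole_regularD r1 r2 k : pole_at r1 k -> regular_at r2 k ->
  pole_at (fun t => r1 t + r2 t) k.
Proof.
move=> [c c0 h1] [c2 _]; exists (c / 2); first by rewrite divr_gt0.
have h2 : (fun t => r2 t * (t - k)) @ k^' --> (0 : R).
  rewrite -(mulr0 (r2 k)); apply: cvgM; last exact: cvg_sub_dnbhs.
  by move=> B /c2 /nbhs_dnbhs.
have c20 : - (c / 2) < 0 by rewrite oppr_lt0 divr_gt0.
by apply: filterS2 h1 (cvg_lt c20 h2) => t; rewrite mulrDl; lra.
Qed.

Lemma poleD r1 r2 k : pole_at r1 k -> pole_at r2 k ->
  pole_at (fun t => r1 t + r2 t) k.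
Proof.
move=> [c c0 h1] [d d0 h2]; exists (c + d); first by rewrite addr_gt0.
by apply: filterS2 h1 h2 => t; rewrite mulrDl; lra.
Qed.

Lemma pole_right F p q : p < q -> pole_at F p ->
  exists2 a, p < a < q & 0 < F a.
Proof.
move=> pq [c c0 [e /= e0 h]]; pose d := Num.min (q - p) e / 2.
have d0 : 0 < d by rewrite divr_gt0 // lt_min subr_gt0 pq.
have dm : d < Num.min (q - p) e by rewrite ltr_pdivrMr // ltr_pMr ?ltr1n // lt_min subr_gt0 pq.
move: (dm); rewrite lt_min => /andP[dq de].
exists (p + d); first by rewrite ltrDl d0 /= -ltrBrDl.
have := h (p + d); rewrite /= opprD addrA subrr sub0r normrN gtr0_norm //.
move=> /(_ de); rewrite -subr_eq0 addrC addKr (gt_eqF d0) => /(_ isT) cF.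
by rewrite -(pmulr_lgt0 _ d0); exact: lt_trans cF.
Qed.

Lemma pole_left F p q : p < q -> pole_at F q ->
  exists2 a, p < a < q & F a < 0.
Proof.
move=> pq [c c0 [e /= e0 h]]; pose d := Num.min (q - p) e / 2.
have d0 : 0 < d by rewrite divr_gt0 // lt_min subr_gt0 pq.
have dm : d < Num.min (q - p) e by rewrite ltr_pdivrMr // ltr_pMr ?ltr1n // lt_min subr_gt0 pq.
move: (dm); rewrite lt_min => /andP[dq de].
exists (q - d); first by apply/andP; split; lra.
have := h (q - d); rewrite /= opprB addrC subrK gtr0_norm //.
move=> /(_ de); rewrite -subr_eq0 addrC addKr oppr_eq0 (gt_eqF d0) => /(_ isT) cF.
rewrite -oppr_gt0 -(pmulr_lgt0 _ d0) mulNr -mulrN; exact: lt_trans cF.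
Qed.

Variables (F : R -> R) (P : set R).
Hypothesis F_reg : forall k, ~ P k -> regular_at F k.
Hypothesis F_pole : forall k, P k -> pole_at F k.

Lemma regular_within_continuous a b :
  (forall t, a <= t <= b -> ~ P t) -> {within `[a, b], continuous F}.
Proof.
move=> noP; apply: continuous_in_subspaceT => x.
by rewrite inE /= in_itv /= => /noP /F_reg[].
Qed.

(** [F] takes a positive value just after [p] and a negative one just before [q]. *)
Lemma zero_exists p q : p < q -> P p -> P q -> (forall t, p < t < q -> ~ P t) ->
  exists2 z, p < z < q & F z = 0.
Proof.
move=> pq Pp Pq noP.
have [a /andP[pa aq] Fa] := pole_right pq (F_pole Pp).
have [b /andP[ab bq] Fb] := pole_left aq (F_pole Pq).
have cF : {within `[a, b], continuous F}.
  apply: regular_within_continuous => t /andP[at_ tb]; apply: noP.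
  by rewrite (lt_le_trans pa at_) (le_lt_trans tb bq).
have : Num.min (F a) (F b) <= 0 <= Num.max (F a) (F b).
  by rewrite ge_min le_max (ltW Fa) (ltW Fb) orbT.
move=> /(IVT (ltW ab) cF)[z]; rewrite in_itv /= => /andP[az zb] Fz.
by exists z; rewrite // (lt_le_trans pa az) (le_lt_trans zb bq).
Qed.

(** Local decrease forces the maximum over the segment to be attained at [x] and the minimum at [y];
    as [F] also goes below [F x] right after [x], the two end values differ. *)
Lemma zero_unique x y : x < y -> (forall t, x <= t <= y -> ~ P t) ->
  F x = 0 -> F y = 0 -> False.
Proof.
move=> xy noP Fx Fy.
have cF := regular_within_continuous noP.
have near_dec t : x <= t <= y -> \forall u \near t^', (F u - F t) * (u - t) < 0.
  by move=> /noP /F_reg[].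
have right t : x <= t < y -> exists2 u, x <= u <= y & F u < F t.
  move=> /andP[xt ty]; have [|e /= e0 h] := near_dec t; first by rewrite xt ltW.
  pose d := Num.min (y - t) e / 2.
  have d0 : 0 < d by rewrite divr_gt0 // lt_min subr_gt0 ty.
  have dm : d < Num.min (y - t) e by rewrite ltr_pdivrMr // ltr_pMr ?ltr1n // lt_min subr_gt0 ty.
  move: (dm); rewrite lt_min => /andP[dy de].
  exists (t + d); first by apply/andP; split; lra.
  have := h (t + d); rewrite /= opprD addrA subrr sub0r normrN gtr0_norm //.
  move=> /(_ de); rewrite -subr_eq0 (addrC t) addrK (gt_eqF d0) => /(_ isT).
  by rewrite pmulr_llt0 // subr_lt0.
have left t : x < t <= y -> exists2 u, x <= u <= y & F t < F u.
  move=> /andP[xt ty]; have [|e /= e0 h] := near_dec t; first by rewrite ty ltW.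
  pose d := Num.min (t - x) e / 2.
  have d0 : 0 < d by rewrite divr_gt0 // lt_min subr_gt0 xt.
  have dm : d < Num.min (t - x) e by rewrite ltr_pdivrMr // ltr_pMr ?ltr1n // lt_min subr_gt0 xt.
  move: (dm); rewrite lt_min => /andP[dy de].
  exists (t - d); first by apply/andP; split; lra.
  have := h (t - d); rewrite /= opprB addrC subrK gtr0_norm //.
  move=> /(_ de); rewrite -subr_eq0 addrC addKr oppr_eq0 (gt_eqF d0) => /(_ isT).
  by rewrite nmulr_llt0 ?oppr_lt0 // subr_gt0.
have itvE t : (t \in `[x, y]) = (x <= t <= y) by rewrite in_itv.
have [M xMy maxM] := EVT_max (ltW xy) cF.
have Mx : M = x.
  move: xMy; rewrite itvE => /andP[xM' My].
  apply/eqP; rewrite eq_le xM' andbT leNgt; apply/negP => xM.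
  have [|u xuy] := left M; first by rewrite xM.
  by rewrite ltNge maxM // itvE.
have [|u xuy Fu] := right x; first by rewrite lexx.
have [m xmy minm] := EVT_min (ltW xy) cF.
have my : m = y.
  move: xmy; rewrite itvE => /andP[xm my'].
  apply/eqP; rewrite eq_le my' leNgt; apply/negP => my.
  have [|w xwy] := right m; first by rewrite xm.
  by rewrite ltNge minm // itvE.
by have := minm u; rewrite itvE my Fy -Fx => /(_ xuy); rewrite leNgt Fu.
Qed.

(** Sending a zero to the last pole before it is a bijection: [zero_unique] gives injectivity and
    [zero_exists] surjectivity. Poles are counted on a half-open interval so that each has a
    successor, at most [b]. *)
Lemma zeros_count (a b : R) (sP sZ : seq R) : a < b -> P a -> P b ->
  uniq sP -> uniq sZ ->
  (forall x, x \in sP <-> P x /\ a <= x < b) ->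
  (forall x, x \in sZ <-> [/\ ~ P x, F x = 0 & a < x < b]) ->
  size sZ = size sP.
Proof.
move=> ab Pa Pb uP uZ sPE sZE.
have /choice[f fE] z : exists p, z \in sZ ->
    [/\ p \in sP, p < z & forall t, p < t <= z -> ~ P t].
  have [zZ|zZ] := boolP (z \in sZ); last by exists z.
  have [nPz Fz /andP[az zb]] := (sZE z).1 zZ.
  have aF : a \in [seq p <- sP | p < z].
    by rewrite mem_filter az; apply/sPE; rewrite lexx ab.
  have [p] := seq_max_exists aF; rewrite mem_filter => /andP[pz pP] pmax.
  exists p => _; split=> // t /andP[pt tz] Pt.
  have tz' : t < z.
    by rewrite lt_neqAle tz andbT; apply/eqP => tzE; apply: nPz; rewrite -tzE.
  have : t \in [seq p <- sP | p < z].
    rewrite mem_filter tz'; apply/sPE; split=> //; apply/andP; split.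
      by have [_ /andP[+ _]] := (sPE p).1 pP => /le_trans; apply; exact: ltW.
    exact: lt_trans zb.
  by move=> /pmax; rewrite leNgt pt.
have finj : {in sZ &, injective f}.
  have step z w : z \in sZ -> w \in sZ -> f z = f w -> z < w -> False.
    move=> zZ wZ fzw zw.
    have [_ Fz _] := (sZE z).1 zZ; have [_ Fw _] := (sZE w).1 wZ.
    apply: (zero_unique zw _ Fz Fw) => t /andP[zt tw].
    have [_ fz _] := fE z zZ; have [_ _ h] := fE w wZ.
    by apply: h; rewrite tw -fzw (lt_le_trans fz zt).
  move=> z w zZ wZ fzw; case: (ltgtP z w) => // h.
    by case: (step z w).
  by case: (step w z).
rewrite -(size_map f); apply: perm_size; apply: uniq_perm => //.
  by rewrite map_inj_in_uniq.
move=> p; apply/mapP/idP => [[z zZ ->]|pP]; first by have [] := fE z zZ.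
have [Pp /andP[ap pb]] := (sPE p).1 pP.
(* [b] is adjoined so that the last counted pole also has a next one. *)
have bF : b \in [seq t <- b :: sP | p < t] by rewrite mem_filter pb mem_head.
have [q] := seq_min_exists bF; rewrite mem_filter => /andP[pq qP] qmin.
have [Pq qb] : P q /\ q <= b.
  move: qP; rewrite inE => /predU1P[->//|/sPE[? /andP[_ /ltW]]//].
have noP t : p < t < q -> ~ P t.
  move=> /andP[pt tq] Pt; have : t \in [seq t <- b :: sP | p < t].
    rewrite mem_filter pt inE; apply/orP; right; apply/sPE; split=> //.
    by rewrite (le_trans ap (ltW pt)) (lt_le_trans tq qb).
  by move=> /qmin; rewrite leNgt tq.
have [z /andP[pz zq] Fz] := zero_exists pq Pp Pq noP.
have zZ : z \in sZ.
  apply/sZE; split=> //; first by apply: noP; rewrite pz.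
  by rewrite (le_lt_trans ap pz) (lt_le_trans zq qb).
exists z => //; have [fP fz noPf] := fE z zZ.
have [Pf _] := (sPE (f z)).1 fP.
case: (ltgtP p (f z)) => // h.
  by case: (noP (f z)) => //; rewrite h (lt_trans fz zq).
by case: (noPf p) => //; rewrite h ltW.
Qed.

End Antitone.

(** * The graph with the loop *)

(* The loop carries [A cos(k(x - l/2)) + s sin(k(x - l/2))]; with
   [C = cos (k l / 2)] and [S = sin (k l / 2)], its coefficients at [0] are
   [a = A C - s S] and [b = A S + s C]. *)
Section LoopAlgebra.
Variables (R : realType) (C S f g : R).
Hypothesis cs : C ^+ 2 + S ^+ 2 = 1.

(** Under the first hypothesis [A * C = f] and [A * S = - g / 2]: the even part has the right value
    at both ends and total flux [- g]. The formula for [A] divides by neither [C] nor [S], either of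
    which may vanish. *)
Lemma loop_extend_conditions s : 2 * S * f + C * g = 0 -> s * S = 0 ->
  let A := C * f - S * (g / 2) in
  let a := A * C - s * S in let b := A * S + s * C in
  [/\ a = f, a * (C * C - S * S) + b * (S * C + C * S) = f &
      g + (b - (b * (C * C - S * S) - a * (S * C + C * S))) = 0].
Proof.
move=> robin ss A a b; split.
- have -> : a = f + (C ^+ 2 + S ^+ 2 - 1) * f - S / 2 * (2 * S * f + C * g) - s * S.
    by rewrite /a /A; field.
  by rewrite cs robin ss; ring.
- have -> : a * (C * C - S * S) + b * (S * C + C * S) =
      f + (C ^+ 2 + S ^+ 2 - 1) * (A * C + s * S + f) -
      S / 2 * (2 * S * f + C * g) + s * S.
    by rewrite /a /b /A; field.
  by rewrite cs robin ss; ring.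
- have -> : g + (b - (b * (C * C - S * S) - a * (S * C + C * S))) =
      (C ^+ 2 + S ^+ 2 - 1) * (A * S - s * C - g) + C * (2 * S * f + C * g).
    by rewrite /a /b /A; field.
  by rewrite cs robin; ring.
Qed.

(** The amplitudes are obtained by rotating [(a, b)] to the midpoint of the loop. Equal values at
    the two ends make the odd part vanish there, and Kirchhoff's condition then involves only the
    even part. *)
Lemma loop_restrict_conditions a b : a = f ->
  a * (C * C - S * S) + b * (S * C + C * S) = f ->
  g + (b - (b * (C * C - S * S) - a * (S * C + C * S))) = 0 ->
  let A := C * f - S * (g / 2) in let s := C * b - S * a in
  [/\ s * S = 0, 2 * S * f + C * g = 0, a = A * C - s * S & b = A * S + s * C].
Proof.
move=> af bE gE A s.
have ss : s * S = 0.
  have -> : s * S = (a * (C * C - S * S) + b * (S * C + C * S) - f + (f - a) -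
      a * (C ^+ 2 + S ^+ 2 - 1)) / 2 by rewrite /s; field.
  by rewrite bE cs af; ring.
have {}gE : g = - (b * (1 - C * C + S * S) + 2 * S * C * a).
  by apply/eqP; rewrite -subr_eq0 -[X in _ == X]gE; apply/eqP; ring.
have AE : A = C * a + S * b.
  have -> : A = C * a + S * b - C * (s * S) + (C ^+ 2 + S ^+ 2 - 1) * (S * b / 2).
    by rewrite /A /s gE af; field.
  by rewrite ss cs; ring.
split=> //.
- have -> : 2 * S * f + C * g = - 2 * S * (s * S) +
      (1 - (C ^+ 2 + S ^+ 2)) * (2 * S * a - C * b).
    by rewrite gE -af /s; ring.
  by rewrite ss cs; ring.
- by rewrite AE -[LHS]mul1r -cs /s; ring.
- by rewrite AE -[LHS]mul1r -cs /s; ring.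
Qed.

End LoopAlgebra.

Section LoopGraph.
Context {R : realType} (G : metric_graph R) (D : {set vertex G}).
Local Notation endpoint := (edge G * bool)%type.
Variables (v : vertex G) (x0 : endpoint) (l : R).
Hypotheses (x0v : vtx x0 = v) (x0_only : forall x, vtx x = v -> x = x0).
Hypothesis vD : v \notin D.
Hypothesis l_gt0 : 0 < l.
Local Notation Gv := (attach_loop v l_gt0).
Local Notation q := (quasi D [set v]%SET).
Local Notation eig := (quasi D finset.set0).

Lemma sum_option (T : finType) (F : option T -> R) :
  \sum_x F x = F None + \sum_t F (Some t).
Proof.
rewrite (bigD1 None) //=; congr (_ + _).
rewrite (reindex_omap Some id) /=; last by case.
by apply: eq_bigl => t; rewrite eqxx.
Qed.

Lemma sum_loop_vertex (F : edge Gv * bool -> R) (u : vertex G) :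
  \sum_(x : edge Gv * bool | vtx x == u) F x =
  \sum_(x : endpoint | vtx x == u) F (Some x.1, x.2) +
  (if u == v then F (None, false) + F (None, true) else 0).
Proof.
rewrite big_mkcond (@sum_endpoints _ Gv) sum_option addrC; congr (_ + _).
  by rewrite [RHS]big_mkcond (@sum_endpoints _ G).
by rewrite /= /loop_vtx /= eq_sym; case: ifP => // _; rewrite addr0.
Qed.

Definition loop_restrict (w : edge Gv * bool -> R) : endpoint -> R :=
  fun x => w (Some x.1, x.2).

Lemma value_loopE k (w : edge Gv * bool -> R) (x : endpoint) :
  @value R Gv k w (Some x.1, x.2) = value k (loop_restrict w) x.
Proof. by []. Qed.

Lemma quasi_loop k (w : edge Gv * bool -> R) :
  let a := w (None, false) in let b := w (None, true) in
  let w' := loop_restrict w in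
  @quasi R Gv D finset.set0 k w <->
  [/\ q k w', a = value k w' x0,
      a * cos (k * l) + b * sin (k * l) = value k w' x0 &
      flux k w' x0 + (b - (b * cos (k * l) - a * sin (k * l))) = 0].
Proof.
move=> a b w'.
have v0 : @value R Gv k w (None, false) = a.
  by rewrite /value /wave /= subrr mulr0 cos0 sin0 mulr1 mulr0 addr0.
have v1 : @value R Gv k w (None, true) = a * cos (k * l) + b * sin (k * l).
  by rewrite /value /wave /= subr0.
have f0 : @flux R Gv k w (None, false) = b.
  by rewrite /flux /dwave /= subrr mulr0 cos0 sin0 mulr1 mulr0 subr0 expr0 mul1r.
have f1 : @flux R Gv k w (None, true) = - (b * cos (k * l) - a * sin (k * l)).
  by rewrite /flux /dwave /= subr0 expr1 mulN1r.
have fl : \sum_(x : endpoint | vtx x == v) flux k w' x = flux k w' x0.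
  rewrite (eq_bigl (pred1 x0)) ?big_pred1_eq // => x /=.
  by apply/eqP/eqP => [/x0_only//|->].
split=> [[w1 w2 w3]|[[w1 w2 w3] aE bE gE]].
  have vx0 b' : @value R Gv k w (None, b') = value k w' x0.
    rewrite -value_loopE; apply: w1; rewrite /= /loop_vtx /=.
    by rewrite -surjective_pairing x0v.
  split.
  - split=> [x y xy|x xD|u uD].
    + rewrite -!value_loopE; apply: w1.
      by rewrite /= /loop_vtx /= -!surjective_pairing.
    + rewrite -value_loopE; apply: w2.
      by rewrite /= /loop_vtx /= -!surjective_pairing.
    + rewrite finset.in_set1 => uv; have := w3 u uD; rewrite inE => /(_ isT).
      by rewrite sum_loop_vertex (negbTE uv) addr0.
  - by rewrite -v0.
  - by rewrite -v1.
  - have := w3 v vD; rewrite inE => /(_ isT).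
    by rewrite sum_loop_vertex eqxx f0 f1 -fl.
have vN b' : @value R Gv k w (None, b') = value k w' x0.
  by case: b'; rewrite ?v1 ?v0.
split.
- have vE (x : edge Gv * bool) (y : endpoint) : vtx x = vtx y :> vertex G ->
      @value R Gv k w x = value k w' y.
    case: x => [[e|] b'] xy; first by rewrite -[LHS]/(value k w' (e, b')); exact: w1.
    by rewrite vN (x0_only (x := y)).
  move=> x y xy; have [y' y'E] := @vtx_surj R G (vtx y).
  by rewrite (vE x y') ?xy ?y'E // (vE y y') ?y'E.
- move=> [[e|] b'] xD; first exact: (w2 (e, b')).
  by case/negP: vD.
- move=> u uD _; rewrite sum_loop_vertex; case: eqP => [->|/eqP uv].
    by rewrite f0 f1 [X in X + _]fl.
  by rewrite addr0; apply: w3; rewrite ?finset.in_set1.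
Qed.

(** The even part on the loop is dictated by the trace of [w]; the amplitude [s] of the odd part is
    the only new degree of freedom. *)
Definition loop_extend k (w : endpoint -> R) (s : R) : edge Gv * bool -> R :=
  let A := cos (k * l / 2) * value k w x0 - sin (k * l / 2) * (flux k w x0 / 2) in
  fun x => match x with
  | (Some e, b) => w (e, b)
  | (None, false) => A * cos (k * l / 2) - s * sin (k * l / 2)
  | (None, true) => A * sin (k * l / 2) + s * cos (k * l / 2)
  end.

Lemma loop_extend_restrict k w s : loop_restrict (loop_extend k w s) = w.
Proof. by apply/funext => -[]. Qed.

Lemma quasi_loop_extend k w s : q k w ->
  2 * sin (k * l / 2) * value k w x0 + cos (k * l / 2) * flux k w x0 = 0 ->
  s * sin (k * l / 2) = 0 ->
  @quasi R Gv D finset.set0 k (loop_extend k w s).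
Proof.
move=> qw robin ss; apply/quasi_loop; rewrite loop_extend_restrict /=.
have kl : k * l = k * l / 2 + k * l / 2 by field.
have -> : cos (k * l) = cos (k * l / 2) * cos (k * l / 2) - sin (k * l / 2) * sin (k * l / 2).
  by rewrite -cosD -kl.
have -> : sin (k * l) = sin (k * l / 2) * cos (k * l / 2) + cos (k * l / 2) * sin (k * l / 2).
  by rewrite -sinD -kl.
by have [-> -> ->] := loop_extend_conditions (cos2Dsin2 _) robin ss.
Qed.

Lemma quasi_loop_robin k (w : edge Gv * bool -> R) :
  @quasi R Gv D finset.set0 k w ->
  exists s, let w' := loop_restrict w in
  [/\ w = loop_extend k w' s, s * sin (k * l / 2) = 0 &
    2 * sin (k * l / 2) * value k w' x0 + cos (k * l / 2) * flux k w' x0 = 0].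
Proof.
move=> /quasi_loop[qw aE bE gE].
exists (cos (k * l / 2) * w (None, true) - sin (k * l / 2) * w (None, false)).
have kl : k * l = k * l / 2 + k * l / 2 by field.
have c2 : cos (k * l) = cos (k * l / 2) * cos (k * l / 2) - sin (k * l / 2) * sin (k * l / 2).
  by rewrite -cosD -kl.
have s2 : sin (k * l) = sin (k * l / 2) * cos (k * l / 2) + cos (k * l / 2) * sin (k * l / 2).
  by rewrite -sinD -kl.
rewrite c2 s2 in bE gE.
have [ss robin a_eq b_eq] := loop_restrict_conditions (cos2Dsin2 _) aE bE gE.
by split=> //; apply: funext => -[[e|] [|]].
Qed.

Lemma loop_extend_lin k c w w' s s' x :
  loop_extend k (fun y => c * w y + w' y) (c * s + s') x =
  c * loop_extend k w s x + loop_extend k w' s' x.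
Proof.
by case: x => -[e|] [|] //=; rewrite !value_lin !flux_lin; field.
Qed.

Lemma loop_extend_eq0 k w s : (forall x, loop_extend k w s x = 0) ->
  (forall x, w x = 0) /\ s = 0.
Proof.
move=> h; have w0 x : w x = 0 by rewrite -[RHS](h (Some x.1, x.2)); case: x.
split=> //; have v0 : value k w x0 = 0 by rewrite /value /wave !w0 !mul0r addr0.
have f0 : flux k w x0 = 0 by rewrite /flux /dwave !w0 !mul0r subr0 mulr0.
have := h (None, false); have := h (None, true).
rewrite /= v0 f0 => hb ha; rewrite -[s]mulr1 -(cos2Dsin2 (k * l / 2)).
rewrite [RHS](_ : 0 = cos (k * l / 2) * 0 - sin (k * l / 2) * 0); last by ring.
by rewrite -[in cos _ * 0]hb -[in sin _ * 0]ha; ring.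
Qed.

(* Both multiplicities are read off the space of waves on [G] that satisfy all
   the vertex conditions except Kirchhoff's at [v]. *)
Lemma has_dim_attach_loop k (f g : R) : 0 < k ->
  (exists w, [/\ q k w, value k w x0 = f & flux k w x0 = g]) ->
  (forall w, q k w -> exists c, value k w x0 = c * f /\ flux k w x0 = c * g) ->
  exists d d' : nat, [/\ has_dim (eigenspace_of D (k ^+ 2)) d,
    has_dim (@eigenspace_of R Gv D (k ^+ 2)) (d' + (sin (k * l / 2) == 0)%R) &
    (d + (g != 0)%R)%N =
    (d' + (2 * sin (k * l / 2) * f + cos (k * l / 2) * g != 0)%R)%N].
Proof.
move=> k0 [w0 [qw0 f0 g0]] line.
have [U UE _] := quasi_space x0v x0_only vD k.
pose Q1 (r : 'rV[R]_#|{: endpoint}|) : R := flux k (row_coef r) x0.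
have Q1lin c a b : Q1 (c *: a + b) = c * Q1 a + Q1 b.
  by rewrite /Q1 row_coef_lin flux_lin.
pose Q2 (r : 'rV[R]_#|{: endpoint}|) : R := 2 * sin (k * l / 2) * value k (row_coef r) x0 +
  cos (k * l / 2) * flux k (row_coef r) x0.
have Q2lin c a b : Q2 (c *: a + b) = c * Q2 a + Q2 b.
  by rewrite /Q2 row_coef_lin value_lin flux_lin; ring.
(* Traces of waves in [U] form the line through [(f, g)], so a linear form in the trace is nonzero
   on [U] exactly when it is nonzero at [(f, g)]. *)
have [W1 W1E /(_ (g != 0)) rk1] := rank_hyperplane U Q1lin.
have [W2 W2E /(_ (2 * sin (k * l / 2) * f + cos (k * l / 2) * g != 0)) rk2] :=
  rank_hyperplane U Q2lin.
have r0 : (coef_row w0 <= U)%MS by apply/UE; rewrite coef_rowK.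
have {}rk1 : (\rank W1 + (g != 0)%R)%N = \rank U.
  apply: rk1; split=> [gn0|[r /UE /line[c [_ fc]]]].
    by exists (coef_row w0); rewrite // /Q1 coef_rowK g0.
  by rewrite /Q1 fc mulf_eq0 negb_or => /andP[].
have {}rk2 : (\rank W2 + (2 * sin (k * l / 2) * f + cos (k * l / 2) * g != 0)%R)%N = \rank U.
  apply: rk2; split=> [gn0|[r /UE /line[c [vc fc]]]].
    by exists (coef_row w0); rewrite // /Q2 coef_rowK f0 g0.
  rewrite /Q2 vc fc; apply: contraNneq => h.
  rewrite (_ : _ + _ = c * (2 * sin (k * l / 2) * f + cos (k * l / 2) * g)); last by ring.
  by rewrite h mulr0.
exists (\rank W1), (\rank W2); split; last by rewrite rk1 rk2.
  apply: (has_dim_param (phi := fun r => wave k (row_coef r))).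
  - by move=> c a b e x; rewrite row_coef_lin wave_lin.
  - move=> r /W1E[/UE qr Q10]; apply: wave_eigenspace.
    exact/(quasi_eig x0v x0_only vD).
  - by move=> r _ /(wave_eq0 k0) /row_coef_eq0.
  - move=> h /(eigenspace_wave k0)[w /(quasi_eig x0v x0_only vD)[qw fw] hw].
    exists (coef_row w); last by rewrite coef_rowK.
    by apply/W1E; split; [apply/UE|]; rewrite /Q1 coef_rowK.
  (* Row space of the pairs [(w, s)]: the last coordinate is free if the sine vanishes and forced to
     be 0 otherwise. *)
  pose B := block_mx W2 0 0 ((sin (k * l / 2) == 0)%:R%:M : 'M[R]_1).
  have rkB : \rank B = (\rank W2 + (sin (k * l / 2) == 0)%R)%N.
    rewrite rank_diag_block_mx; congr (_ + _)%N.
    by case: (_ == _); rewrite ?mxrank1 // (_ : 0%:M = 0) ?mxrank0 // raddf0.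
  have BE (r : 'rV[R]_(#|{: endpoint}| + 1)) : (r <= B)%MS <->
      [/\ q k (row_coef (lsubmx r)), Q2 (lsubmx r) = 0 &
          rsubmx r 0 0 * sin (k * l / 2) = 0].
    split=> [/submxP[c cE]|[qr Q20 rs]].
      have [lr rr] : lsubmx r = lsubmx c *m W2 /\
          rsubmx r = rsubmx c *m (sin (k * l / 2) == 0)%:R%:M.
        rewrite cE -{1 3}(hsubmxK c) /B mul_row_block !mulmx0 addr0 add0r.
        by rewrite row_mxKl row_mxKr.
      have /W2E[/UE qr Q20] : (lsubmx r <= W2)%MS by rewrite lr submxMl.
      split=> //; rewrite rr mul_mx_scalar mxE; case: eqP => [->|_].
        by rewrite mulr0.
      by rewrite !mul0r.
    have /submxP[c cE] : (lsubmx r <= W2)%MS by apply/W2E; split=> //; exact/UE.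
    apply/submxP; exists (row_mx c (rsubmx r)).
    rewrite -{1}(hsubmxK r) /B mul_row_block !mulmx0 addr0 add0r cE; congr row_mx.
    rewrite mul_mx_scalar; move/eqP: rs; rewrite mulf_eq0 => /orP[|->].
      move=> /eqP r00; have -> : rsubmx r = 0; last by rewrite scaler0.
      by apply/matrixP => i j; rewrite !ord1 r00 mxE.
    by rewrite scale1r.
  rewrite -rkB; apply: (has_dim_param (phi := fun r =>
    @wave R Gv k (loop_extend k (row_coef (lsubmx r)) (rsubmx r 0 0)))).
  + move=> c a b e x; rewrite -wave_lin; congr (@wave R Gv k _ e x).
    apply: funext => y; rewrite -loop_extend_lin; congr (loop_extend k _ _ y).
      by rewrite linearP row_coef_lin.
    by rewrite linearP !mxE.
  + by move=> r /BE[qr Q20 rs]; apply: wave_eigenspace; exact: quasi_loop_extend.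
  + move=> r _ /(wave_eq0 k0)/loop_extend_eq0[/row_coef_eq0 lr rr].
    rewrite -(hsubmxK r) lr (_ : rsubmx r = 0) ?row_mx0 //.
    by apply/matrixP => i j; rewrite !ord1 rr mxE.
  + move=> h /(eigenspace_wave k0)[w qw hw].
    have [s [wE ss robin]] := quasi_loop_robin qw.
    exists (row_mx (coef_row (loop_restrict w)) s%:M).
      apply/BE; rewrite row_mxKl row_mxKr coef_rowK mxE eqxx mulr1n; split=> //.
        by have /quasi_loop[] := qw.
      by rewrite /Q2 coef_rowK.
    by rewrite row_mxKl row_mxKr coef_rowK mxE eqxx mulr1n -wE.
Qed.

End LoopGraph.

(** * The eigenvalue 0, whose eigenfunctions are not parametrised by waves *)

Section LoopGraphZero.
Context {R : realType} (G : metric_graph R) (D : {set vertex G}).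
Local Notation endpoint := (edge G * bool)%type.
Variables (v : vertex G) (x0 : endpoint) (l : R).
Hypotheses (x0v : vtx x0 = v) (x0_only : forall x, vtx x = v -> x = x0).
Hypothesis vD : v \notin D.
Hypothesis l_gt0 : 0 < l.
Local Notation Gv := (attach_loop v l_gt0).

Definition loop_constant (f : graph_fun G) : graph_fun Gv :=
  fun e => if e is Some e' then f e' else fun=> f x0.1 (endpt x0.1 x0.2).

Lemma eigenspace0_extend f : eigenspace_of D 0 f ->
  @eigenspace_of R Gv D 0 (loop_constant f).
Proof.
move=> [p [g [sob cont dir kir ae]]].
exists (fun e => if e is Some e' then p e' else fun=> 0),
  (fun e => if e is Some e' then g e' else fun=> 0); split.
- case=> [e|] /=; first exact: sob.
  apply: smooth_sobolev2 => // x; first exact: cvg_cst.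
- have valE e b : loop_constant f e (@endpt R Gv e b) =
      (if e is Some e' then f e' (endpt e' b) else f x0.1 (endpt x0.1 x0.2)).
    by case: e.
  have e0 e b : vtx (e, b) = v -> f e (endpt e b) = f x0.1 (endpt x0.1 x0.2).
    by move=> /x0_only <-.
  move=> [e|] [e'|] b b' ee'; rewrite !valE //.
  + exact: cont.
  + exact: e0 ee'.
  + by apply/esym; apply: e0; exact: esym ee'.
- move=> [e|] b eD; first exact: (dir e b).
  by case/negP: vD.
- move=> u uD; rewrite sum_loop_vertex /= !mulr0 addr0 if_same addr0.
  exact: (kir u uD).
- case=> [e|]; first exact: (ae e).
  by apply: aeW => x _; rewrite /= mul0r oppr0.
Qed.

(** On the loop the function is affine with equal end values, hence constant; the loop carries no
    flux, and Kirchhoff's condition at [v] is the one on [G]. *)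
Lemma eigenspace0_restrict h : @eigenspace_of R Gv D 0 h ->
  eigenspace_of D 0 (fun e => h (Some e)) /\
  eq_on_graph h (loop_constant (fun e => h (Some e))).
Proof.
move=> [p [g [sob cont dir kir ae]]].
have [cf cp df dp] := sobolev2_ode l_gt0 (sob None) (ae None).
have p0 : {in `[0, l], forall x, p None x = p None 0}.
  apply: is_derive0_segment => // x /dp; rewrite oppr0 mul0r; exact.
have f0 : {in `[0, l], forall x,
    h None x + - p None 0 * x = h None 0 + - p None 0 * 0}.
  apply: (is_derive0_segment (f := fun x => h None x + - p None 0 * x)).
    move=> x; apply: cvgD; first exact: cf.
    by apply: cvgMr; apply: continuous_subspaceT => y; exact: cvg_id.
  move=> x xl; have := is_deriveD (df x xl) (is_deriveZ (- p None 0) (is_derive_id x (1 : R))).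
  congr (is_derive _ _ _ _); rewrite p0; last exact: subset_itv_oo_cc xl.
  by rewrite /GRing.scale /= mulr1 subrr.
have l_in : l \in `[0, l] by rewrite in_itv /= lexx ltW.
have hl : h None l = h None 0.
  by apply: (cont None None true false); rewrite /= /loop_vtx.
have pN : p None 0 = 0.
  have /eqP := f0 l l_in; rewrite hl mulr0 addr0 -subr_eq0 addrC addKr.
  by rewrite mulf_eq0 oppr_eq0 (gt_eqF l_gt0) orbF => /eqP.
have hx : h None 0 = h (Some x0.1) (endpt x0.1 x0.2).
  apply: (cont None (Some x0.1) false x0.2).
  by rewrite /= /loop_vtx /= -surjective_pairing x0v.
split; last first.
  move=> [e|] x xe //=; rewrite -hx.
  by have := f0 x xe; rewrite pN oppr0 !mul0r !addr0.
exists (fun e => p (Some e)), (fun e => g (Some e)); split.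
- by move=> e; exact: (sob (Some e)).
- by move=> e e' b b' ee'; exact: (cont (Some e) (Some e') b b').
- by move=> e b; exact: (dir (Some e) b).
- move=> u uD; have := kir u uD; rewrite sum_loop_vertex /=.
  by rewrite (p0 l l_in) pN !mulr0 addr0 if_same addr0.
- by move=> e; exact: (ae (Some e)).
Qed.

Lemma has_dim_attach_loop0 d : has_dim (eigenspace_of D 0) d ->
  has_dim (@eigenspace_of R Gv D 0) d.
Proof.
move=> [f [Vf fli fsp]]; exists (fun i => loop_constant (f i)); split.
- by move=> i; exact: eigenspace0_extend.
- by move=> c c0; apply: fli => e x xe; exact: (c0 (Some e) x xe).
- move=> h /eigenspace0_restrict[/fsp[c hc] hE]; exists c => -[e|] x xe.
    exact: hc.
  rewrite hE //= (hc x0.1); last exact: endpt_itv.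
  by [].
Qed.

End LoopGraphZero.

(** * Enumeration of a spectrum *)

Lemma card_seq_size (T : choiceType) (A : set T) (q : seq T) (n : nat) : uniq q ->
  (forall x, A x <-> x \in q) -> (A #= `I_n)%card <-> size q = n.
Proof.
move=> uq Aq; have finA : finite_set A.
  by apply/finite_seqP; exists q; apply/seteqP; split=> x /Aq.
have key m : (A #= `I_m)%card -> size q = m.
  move=> /card_fset_set <-; apply: perm_size; apply: uniq_perm => //.
  by move=> x; rewrite in_fset_set //; apply/idP/idP => [/Aq/mem_set//|/set_mem/Aq].
split=> [/key//|<-].
by have /finite_setP[m Am] := finA; rewrite (key m Am).
Qed.

Lemma card_fiber_neq0 (T : Type) (s : nat -> T) (z : T) (d : nat) :
  ([set i | s i = z] #= `I_d)%card -> d != 0%N <-> exists i, s i = z.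
Proof.
move=> fib; split=> [d0|[i iz]]; last first.
  apply/eqP => d0; move: fib; rewrite d0 II0 card_eq0 => /eqP e.
  by have : [set i | s i = z] i by []; rewrite e.
apply: contrapT => nz; case/negP: d0; apply/eqP/esym.
have e : [set i | s i = z] = set0.
  by apply/seteqP; split=> // i siz; apply: nz; exists i.
by move: fib; rewrite e => /(card_seq_size (q := [::]) _ _) <-.
Qed.

Lemma card_interval (a n : nat) : ([set i | (a <= i < a + n)%N] #= `I_n)%card.
Proof.
apply/(card_seq_size _ (iota_uniq a n)); last by rewrite size_iota.
by move=> i; rewrite mem_iota.
Qed.

Section Enumeration.
Context {R : realType}.
Implicit Types (d : R -> nat) (s : nat -> R) (t : seq R).

(** For a multiplicity function [d] and a duplicate-free list [t] containing its support below [x],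
    this is the number of eigenvalues below [x]. *)
Definition count_below d t (x : R) : nat := \sum_(y <- t | y < x) d y.

Lemma eq_count_below d t t' x : uniq t -> uniq t' ->
  (forall y, y < x -> d y != 0%N -> (y \in t) = (y \in t')) ->
  count_below d t x = count_below d t' x.
Proof.
move=> ut ut' tt'.
have key u : count_below d u x = \sum_(y <- [seq y <- u | (y < x) && (d y != 0%N)]) d y.
  rewrite big_filter /count_below [RHS]big_mkcondr; apply: eq_bigr => y _.
  by case: eqP.
rewrite !key; apply: perm_big; apply: uniq_perm; rewrite ?filter_uniq // => y.
rewrite !mem_filter; case: (ltP y x) => //= yx.
by case: eqP => //= /eqP dy; rewrite tt'.
Qed.

Lemma count_below_lt d t x y : uniq t -> x < y -> x \in t ->
  (count_below d t x + d x <= count_below d t y)%N.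
Proof.
move=> ut xy xt; rewrite /count_below [leqRHS]big_mkcond (bigD1_seq x) //= xy.
rewrite addnC leq_add2l [leqLHS]big_mkcond [leqRHS]big_mkcond; apply: leq_sum => z _.
by case: ifP => // zx; rewrite (lt_trans zx xy) (lt_eqF zx).
Qed.

Lemma count_below_succ d t x y : uniq t -> x < y -> x \in t ->
  (forall z, x < z < y -> d z = 0%N) ->
  count_below d t y = (count_below d t x + d x)%N.
Proof.
move=> ut xy xt d0; rewrite /count_below [LHS]big_mkcond (bigD1_seq x) //= xy.
rewrite addnC; congr (_ + _)%N; rewrite [LHS]big_mkcond [RHS]big_mkcond; apply: eq_bigr => z _.
case: (ltgtP z x) => [zx|xz|->]; rewrite ?(lt_trans zx xy) ?andbF ?andbT //.
by case: ltP => // zy; rewrite d0 // xz.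
Qed.

(** In a nondecreasing enumeration indexed from 0, the first index of a value is the number of terms
    below it. *)
Lemma monotone_fiber d s t z : (forall i j, (i <= j)%N -> s i <= s j) ->
  (forall y, ([set i | s i = y] #= `I_(d y))%card) -> uniq t ->
  (forall y, y < z -> d y != 0%N -> y \in t) -> d z != 0%N ->
  forall i, s i = z <-> (count_below d t z <= i < count_below d t z + d z)%N.
Proof.
move=> mono fib ut tE dz.
have ex0 y : d y != 0%N -> exists i, s i = y by move/(card_fiber_neq0 (fib y)).
have [i0 i0z] := ex0 z dz.
have exM0 : exists i, z <= s i by exists i0; rewrite i0z.
case: (ex_minnP exM0) => M0 zM0 M0min.
have lt0 i : (s i < z) = (i < M0)%N.
  apply/idP/idP => [iz|iM].
    by rewrite ltnNge; apply: contraTN iz => /mono M0i; rewrite -leNgt (le_trans zM0).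
  by rewrite ltNge; apply: contraTN iM => /M0min; rewrite -leqNgt.
(* Otherwise the fibre of [z] would be infinite. *)
have exM1 : exists i, z < s i.
  apply: contrapT => nz; have nz' i : s i <= z.
    by rewrite leNgt; apply/negP => h; apply: nz; exists i.
  have fz i : s (M0 + i)%N = z.
    by apply: le_anti; rewrite nz' (le_trans zM0) // mono // leq_addr.
  have /finite_seqP[q qE] : finite_set [set i | s i = z].
    by apply/finite_setP; exists (d z).
  have sub : {subset iota M0 (size q).+1 <= q}.
    move=> i; rewrite mem_iota => /andP[M0i _].
    have : [set i | s i = z] i by rewrite /= -(subnKC M0i) fz.
    by rewrite qE.
  by have := uniq_leq_size (iota_uniq _ _) sub; rewrite size_iota ltnn.
case: (ex_minnP exM1) => M1 zM1 M1min.
have le1 i : (s i <= z) = (i < M1)%N.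
  apply/idP/idP => [iz|iM].
    rewrite ltnNge; apply: contraTN iz => /mono M1i; rewrite -ltNge.
    exact: lt_le_trans M1i.
  by rewrite leNgt; apply: contraTN iM => /M1min; rewrite -leqNgt.
have M01 : (M0 <= M1)%N.
  rewrite leqNgt; apply/negP; rewrite -lt0 => h.
  by have := lt_trans h zM1; rewrite ltxx.
have fibE i : s i = z <-> (M0 <= i < M1)%N.
  rewrite leqNgt -lt0 -le1 -leNgt; split=> [->|h]; first by rewrite lexx.
  by apply: le_anti; rewrite andbC.
have M1E : M1 = (M0 + d z)%N.
  have /(card_seq_size (d z) (iota_uniq M0 (M1 - M0))) : forall i,
      [set i | s i = z] i <-> i \in iota M0 (M1 - M0).
    by move=> i; rewrite mem_iota subnKC //; exact: fibE.
  by move=> /iffLR/(_ (fib z)); rewrite size_iota => <-; rewrite subnKC.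
(* The first [M0] terms of [s] are those below [z]; grouped by value, each [y] occurs [d y] times
   among them. *)
have -> : count_below d t z = M0; last by move=> i; rewrite -M1E.
rewrite -[RHS](size_iota 0) -(size_map s).
rewrite -(eq_count_below (t := undup (map s (iota 0 M0)))) ?undup_uniq //; last first.
  move=> y yz dy; rewrite mem_undup tE //; apply/mapP.
  by have [i iy] := ex0 y dy; exists i; rewrite // mem_iota /= -lt0 iy.
rewrite /count_below -big_filter (eq_in_filter (a2 := predT)); last first.
  by move=> y; rewrite mem_undup => /mapP[i]; rewrite mem_iota /= => iM ->; rewrite lt0.
rewrite filter_predT; set q := map s _.
rewrite -(perm_size (perm_count_undup q)) size_flatten /shape -map_comp sumnE big_map.
apply: eq_big_seq => y; rewrite mem_undup => /mapP[i0']; rewrite mem_iota /= => i0M yE.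
rewrite size_nseq /q count_map -size_filter; apply/esym.
apply/(card_seq_size _ _ _ : (_ #= `I_(d y))%card <-> _); last exact: (fib y).
  by rewrite filter_uniq // iota_uniq.
move=> i /=; rewrite mem_filter mem_iota /=; split=> [iy|/andP[/eqP//]].
by rewrite iy eqxx /= -lt0 iy yE lt0.
Qed.

Variable d : R -> nat.
Hypothesis d_fin : forall b, exists2 t : seq R, uniq t &
  forall x, x \in t <-> d x != 0%N /\ x <= b.
Hypothesis d_unbounded : forall b, exists2 x, b < x & d x != 0%N.

(** With [c z] the total multiplicity below [z], the blocks from [c z] to [c z + d z] tile the
    natural numbers as [z] runs over the support of [d]; [s i] is the [z] whose block contains
    [i]. *)
Lemma enumeration_exists : exists s : nat -> R,
  (forall i j, (i <= j)%N -> s i <= s j) /\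
  forall z, ([set i | s i = z] #= `I_(d z))%card.
Proof.
have /choice[t tE] (b : R) : exists t : seq R, uniq t /\
    forall x, x \in t <-> d x != 0%N /\ x <= b.
  by have [t ut tE] := d_fin b; exists t.
pose c x := count_below d (t x) x.
have cE b x : x <= b -> c x = count_below d (t b) x.
  move=> xb; apply: eq_count_below; rewrite ?(tE _).1 // => y yx dy.
  have [_ tx] := tE x; have [_ tb] := tE b.
  have -> : y \in t x by apply/tx; rewrite dy (ltW yx).
  by apply/esym/tb; rewrite dy (le_trans (ltW yx) xb).
have in_t x b : d x != 0%N -> x <= b -> x \in t b.
  by move=> dx xb; have [_ tb] := tE b; apply/tb.
have c_lt x y : d x != 0%N -> x < y -> (c x + d x <= c y)%N.
  move=> dx xy; rewrite (cE y x (ltW xy)).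
  by apply: count_below_lt => //; [have [] := tE y|exact: in_t (ltW xy)].
have c_succ x y : d x != 0%N -> x < y -> (forall z, x < z < y -> d z = 0%N) ->
    c y = (c x + d x)%N.
  move=> dx xy d0; rewrite (cE y x (ltW xy)).
  by apply: count_below_succ => //; [have [] := tE y|exact: in_t (ltW xy)].
have next x : exists y, [/\ x < y, d y != 0%N & forall z, x < z < y -> d z = 0%N].
  have [y xy dy] := d_unbounded x.
  have yF : y \in [seq z <- t y | x < z] by rewrite mem_filter xy in_t.
  have [m] := seq_min_exists yF; rewrite mem_filter => /andP[xm mt] mmin.
  have [dm my] : d m != 0%N /\ m <= y by have [_ /(_ m)[+ _]] := tE y; exact.
  exists m; split=> // z /andP[xz zm]; apply/eqP; apply: contraTT zm => dz.
  rewrite -leNgt; have [zy|/ltW yz] := leP z y; last exact: le_trans yz.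
  by apply: mmin; rewrite mem_filter xz in_t.
have first : exists y, d y != 0%N /\ c y = 0%N.
  have [y _ dy] := d_unbounded 0.
  have [m mt mmin] := seq_min_exists (in_t y y dy (lexx y)).
  have [dm my] : d m != 0%N /\ m <= y by have [_ /(_ m)[+ _]] := tE y; exact.
  exists m; split=> //; rewrite (cE y) // /count_below big1_seq // => z /andP[zm zt].
  by move: zm; rewrite ltNge mmin.
have loc i : exists z, (c z <= i < c z + d z)%N.
  elim: i => [|i [z /andP[cz iz]]].
    by have [y [dy cy]] := first; exists y; rewrite cy add0n lt0n.
  have dz : d z != 0%N by lia.
  have [h|h] := ltnP i.+1 (c z + d z); first by exists z; lia.
  have [y [zy dy gap]] := next z; exists y.
  by rewrite (c_succ z y) //; lia.
have [s sE] := choice loc.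
have s_uniq i z : (c z <= i < c z + d z)%N -> s i = z.
  move=> iz; have iz' := sE i; case: (ltgtP (s i) z) => // h.
    have := c_lt (s i) z _ h; have : d (s i) != 0%N by lia.
    by move=> /[swap]/[apply]; lia.
  have := c_lt z (s i) _ h; have : d z != 0%N by lia.
  by move=> /[swap]/[apply]; lia.
exists s; split.
  move=> i j ij; rewrite leNgt; apply/negP => h.
  have iz := sE i; have jz := sE j.
  have := c_lt (s j) (s i) _ h; have : d (s j) != 0%N by lia.
  by move=> /[swap]/[apply]; lia.
move=> z; rewrite (_ : [set i | s i = z] = [set i | (c z <= i < c z + d z)%N]).
  exact: card_interval.
by apply/seteqP; split=> i /= => [<-|/s_uniq//]; exact: sE.
Qed.

End Enumeration.

(** * Counting eigenvalues *)

Section LoopWeyl.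
Context {R : realType} (l : R).
Hypothesis l_gt0 : 0 < l.
(** [f] and [g] are the value at [v] and the total flux into the loop of the even wave
    [cos (t * (x - l / 2))]. *)
Let f (t : R) := cos (t * l / 2).
Let g (t : R) := 2 * sin (t * l / 2).

Lemma loop_trace_limit k (F : set_system R) : UltraFilter F -> k^' `<=` F ->
  exists c : R, [/\ c ^+ 2 = 1, f @ F --> c * f k, g @ F --> c * g k &
    (fun t => (f k * g t - g k * f t) / (t - k)) @ F --> c * l].
Proof.
move=> FU kF; exists 1; rewrite expr1n !mul1r; split=> //.
- by rewrite /f; under eq_fun do rewrite -mulrA; rewrite -mulrA; exact: cvg_cos_mul.
- apply: cvg_scale; under eq_fun do rewrite -mulrA; rewrite -mulrA.
  exact: cvg_sin_mul.
- have d : is_derive k 1 (fun t => sin (l / 2 * (t - k))) (l / 2).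
    by have := is_derive_sin_affine (l / 2) k k; rewrite subrr mulr0 cos0 mulr1.
  have h : (fun t => 2 * ((sin (l / 2 * (t - k)) - sin (l / 2 * (k - k))) / (t - k)))
      @ F --> l.
    rewrite [X in _ --> X](_ : l = 2 * (l / 2)); last by field.
    by apply: cvg_scale; exact: (cvg_slope (f := fun t => sin (l / 2 * (t - k)))).
  apply: cvg_near_eq h; apply: nearW => t.
  rewrite subrr mulr0 sin0 subr0 mulrA; congr (_ / _).
  rewrite (_ : l / 2 * (t - k) = t * l / 2 - k * l / 2); last by field.
  by rewrite sinB /f /g; ring.
Qed.

Lemma loop_trace_neq0 k : (f k != 0) || (g k != 0).
Proof.
rewrite -negb_and; apply/negP => /andP[/eqP f0]; rewrite mulf_eq0 pnatr_eq0 /= => /eqP s0.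
have := cos2Dsin2 (k * l / 2); rewrite -/(f k) f0 s0 expr0n addr0 => /eqP.
by rewrite eq_sym oner_eq0.
Qed.

Lemma loop_regular k : sin (k * l / 2) != 0 ->
  regular_at (fun t => f t / g t) k /\ \forall t \near k^', g t != 0.
Proof.
move=> s0; apply: trace_pair_regular l_gt0 (@loop_trace_limit k) _.
by rewrite mulf_neq0 ?pnatr_eq0.
Qed.

Lemma loop_pole k : sin (k * l / 2) = 0 ->
  pole_at (fun t => f t / g t) k /\ \forall t \near k^', g t != 0.
Proof.
move=> s0; apply: trace_pair_pole l_gt0 (loop_trace_neq0 k) (@loop_trace_limit k) _.
by rewrite /g s0 mulr0.
Qed.

End LoopWeyl.

Lemma sinDnpi (R : realType) (x : R) n : sin (x + n%:R * pi) = (-1) ^+ n * sin x.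
Proof.
elim: n => [|n IH]; first by rewrite mul0r addr0 expr0 mul1r.
by rewrite -natr1 mulrDl mul1r addrA sinDpi IH exprS mulN1r mulNr.
Qed.

Lemma sin_eq0_nat (R : realType) (x : R) : 0 <= x -> sin x = 0 ->
  exists n, x = n%:R * pi.
Proof.
move=> x0 sx; have pi0 := pi_gt0 R.
exists (Num.truncn (x / pi)); set n := Num.truncn _.
have [nx xn] : n%:R * pi <= x /\ x < n.+1%:R * pi.
  have /andP[] := truncn_itv (divr_ge0 x0 (ltW pi0)).
  by rewrite ler_pdivlMr // ltr_pdivrMr.
apply/eqP; rewrite eq_sym eq_le nx leNgt; apply/negP => xgt.
have := sinDnpi (x - n%:R * pi) n; rewrite subrK sx => /esym/eqP.
rewrite mulf_eq0 signr_eq0 /= => /eqP s0.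
have : 0 < sin (x - n%:R * pi).
  apply: sin_gt0_pi; rewrite subr_gt0 xgt /= ltrBlDl.
  by move: xn; rewrite -natr1 mulrDl mul1r.
by rewrite s0 ltxx.
Qed.

Lemma sin_npi (R : realType) n : sin (n%:R * pi : R) = 0.
Proof. by rewrite -[X in sin X]add0r sinDnpi sin0 mulr0. Qed.

(** * Counting Robin roots against poles *)

Section Interlacing.
Context {R : realType} (f g : R -> R) (l : R) (j : nat).
Hypothesis l_gt0 : 0 < l.
Hypothesis j_gt0 : (0 < j)%N.
Hypothesis fg0 : forall k, (f k != 0) || (g k != 0).
Hypothesis fg_regular : forall k, g k != 0 ->
  regular_at (fun t => f t / g t) k /\ \forall t \near k^', g t != 0.
Hypothesis fg_pole : forall k, g k = 0 ->
  pole_at (fun t => f t / g t) k /\ \forall t \near k^', g t != 0.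
Implicit Types k : R.

Definition neumann_root k := g k == 0.
Definition loop_root k := sin (k * l / 2) == 0.
(** The equation [F k = 0] for the [F] below, with denominators cleared so that it also makes sense
    at poles. Roots at poles are exactly those where [g] and the sine vanish together. *)
Definition robin_root k := 2 * sin (k * l / 2) * f k + cos (k * l / 2) * g k == 0.

Let F t := f t / g t + cos (t * l / 2) / (2 * sin (t * l / 2)).
Let P : set R := [set k | neumann_root k || loop_root k].

Lemma robin_regular k : ~ P k -> regular_at F k.
Proof.
move=> /negP; rewrite negb_or => /andP[gk sk]; apply: regularD.
  by have [] := fg_regular gk.
by have [] := loop_regular l_gt0 sk.
Qed.

Lemma robin_pole k : P k -> pole_at F k.
Proof.
rewrite /P /= /neumann_root /loop_root.
have [/fg_pole[pf _] _|/fg_regular[rf _] /= sk] := eqVneq (g k) 0.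
  have [/(loop_pole l_gt0)[ps _]|/(loop_regular l_gt0)[rs _]] :=
    eqVneq (sin (k * l / 2)) 0; [exact: poleD|exact: pole_regularD].
have [ps _] := loop_pole l_gt0 (eqP sk).
have h := pole_regularD ps rf; rewrite /F.
by under eq_fun do rewrite addrC.
Qed.

Lemma neumann_root_isolated k : \forall t \near k^', ~~ neumann_root t.
Proof. by have [/fg_pole[]|/fg_regular[]] := eqVneq (g k) 0. Qed.

Lemma loop_root_isolated k : \forall t \near k^', ~~ loop_root t.
Proof.
have [/(loop_pole l_gt0)[_]|/(loop_regular l_gt0)[_]] := eqVneq (sin (k * l / 2)) 0;
  by apply: filterS => t; rewrite mulf_eq0 pnatr_eq0.
Qed.

Lemma robin_rootE k : ~ P k -> robin_root k = (F k == 0).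
Proof.
move=> /negP; rewrite negb_or => /andP[gk sk].
have g2s : g k * (2 * sin (k * l / 2)) != 0 by rewrite !mulf_neq0 ?pnatr_eq0.
rewrite /F addf_div ?mulf_neq0 ?pnatr_eq0 // mulf_eq0 invr_eq0 (negbTE g2s) orbF.
by rewrite /robin_root; congr (_ == _); ring.
Qed.

Lemma robin_root_loop k : loop_root k -> robin_root k = neumann_root k.
Proof.
move=> /eqP sk; rewrite /robin_root sk mulr0 mul0r add0r mulf_eq0.
have := cos2Dsin2 (k * l / 2); rewrite sk [0 ^+ 2]expr0n addr0.
have [->|//] := eqVneq (cos (k * l / 2)) 0.
by rewrite expr0n => /eqP; rewrite eq_sym oner_eq0.
Qed.

Lemma robin_root_neumann k : neumann_root k -> ~~ loop_root k -> ~~ robin_root k.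
Proof.
move=> /eqP gk sk; have := fg0 k; rewrite /robin_root gk eqxx orbF mulr0 addr0 => fk.
by rewrite !mulf_neq0 // pnatr_eq0.
Qed.

Lemma robin_root_isolated k : \forall t \near k^', ~~ robin_root t.
Proof.
have Fn0 : \forall t \near k^', F t != 0.
  have [/robin_pole[c c0]|/robin_regular[cF dF]] := pselect (P k).
    by apply: filterS => t; apply: contraTneq => ->; rewrite mul0r -leNgt ltW.
  have [F0|F0] := eqVneq (F k) 0.
    by apply: filterS dF => t; apply: contraTneq => ->; rewrite F0 subrr mul0r ltxx.
  apply: nbhs_dnbhs; apply: (cF [set y | y != 0]).
  by apply: open_nbhs_nbhs; split=> //; exact: open_neq.
apply: filterS3 (neumann_root_isolated k) (loop_root_isolated k) Fn0 => t nt lt Ft.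
by rewrite robin_rootE //; apply/negP; rewrite negb_or nt lt.
Qed.

Let kap : R := 2 * j%:R * pi / l.

Lemma loop_root0 : loop_root 0.
Proof. by rewrite /loop_root !mul0r sin0. Qed.

Lemma kap_gt0 : 0 < kap.
Proof. by rewrite divr_gt0 // !mulr_gt0 ?pi_gt0 ?ltr0n. Qed.

Lemma loop_rootP k : 0 <= k -> reflect (exists i : nat, k = 2 * i%:R * pi / l) (loop_root k).
Proof.
move=> k0; apply: (iffP eqP) => [|[i ->]].
  have kl : 0 <= k * l / 2 by rewrite divr_ge0 // mulr_ge0 // ltW.
  move=> /(sin_eq0_nat kl)[i iE]; exists i.
  have -> : k = k * l / 2 * 2 / l by field; rewrite gt_eqF.
  by rewrite iE; congr (_ / _); ring.
have -> : 2 * i%:R * pi / l * l / 2 = i%:R * pi by field; rewrite gt_eqF.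
exact: sin_npi.
Qed.

Lemma loop_root_kap : loop_root kap.
Proof. by apply/loop_rootP; [exact: ltW kap_gt0|exists j]. Qed.

Variable K : seq R.
Hypothesis uniq_K : uniq K.
Hypothesis K_itv : forall k, k \in K -> 0 < k < kap.
Hypothesis K_roots : forall k, 0 < k < kap ->
  [|| neumann_root k, robin_root k | loop_root k] -> k \in K.

(** The nonnegative roots are [2 * i * pi / l]; the indices 0 and [j] give the excluded ends 0 and
    [kap]. *)
Lemma count_loop_root : count loop_root K = j.-1.
Proof.
pose h (i : nat) : R := 2 * i%:R * pi / l.
have h_lt a b : (h a < h b) = (a < b)%N.
  rewrite /h ltr_pM2r ?invr_gt0 // ltr_pM2r ?pi_gt0 // ltr_pM2l //.
  exact: ltr_nat.
have h_inj : injective h.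
  move=> a b hab; have := h_lt a b; have := h_lt b a; rewrite hab ltxx.
  by move=> /esym/negbT + /esym/negbT; lia.
rewrite -size_filter -[RHS](size_iota 1) -(size_map h); apply: perm_size.
apply: uniq_perm; rewrite ?filter_uniq ?map_inj_uniq ?iota_uniq // => k.
rewrite mem_filter; apply/andP/mapP => [[lk kK]|[i]].
  have /andP[k0 kj] := K_itv kK; have [i kE] := loop_rootP (ltW k0) lk.
  exists i => //; rewrite mem_iota.
  have h0 : h 0%N = 0 by rewrite /h mulr0 !mul0r.
  by move: k0 kj; rewrite kE -{1}h0 -/(h i) -/(h j) !h_lt; lia.
rewrite mem_iota => ij ->; have li : loop_root (h i).
  by apply/loop_rootP; [rewrite /h divr_ge0 ?mulr_ge0 ?pi_ge0 // ltW|exists i].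
split=> //; apply: K_roots; last by rewrite li !orbT.
have h0 : h 0%N = 0 by rewrite /h mulr0 !mul0r.
by rewrite -{1}h0 -/(h j) !h_lt; lia.
Qed.

(** Write A, C for the Neumann and loop roots in [K]. Zeros of [F] number 1 + #(A or C), the 1 being
    the pole at 0; Robin roots at poles number #(A and C). The total is 1 + #A + #C, and #C = j -
    1. *)
Lemma count_robin_root : count robin_root K = (count neumann_root K + j)%N.
Proof.
pose pol k := neumann_root k || loop_root k.
have zc : size [seq k <- K | robin_root k & ~~ pol k] = size (0 :: [seq k <- K | pol k]).
  have P0 : P 0 by rewrite /P /= loop_root0 orbT.
  have Pk : P kap by rewrite /P /= loop_root_kap orbT.
  apply: (zeros_count robin_regular robin_pole kap_gt0 P0 Pk).
  - rewrite /= filter_uniq // andbT mem_filter negb_and; apply/orP; right.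
    by apply/negP => /K_itv; rewrite ltxx.
  - exact: filter_uniq.
  - move=> k; rewrite inE mem_filter; split=> [/predU1P[->|/andP[pk /K_itv/andP[k0 kk]]]|].
    + by rewrite lexx kap_gt0.
    + by rewrite ltW.
    + move=> [pk /andP[]]; rewrite le_eqVlt => /predU1P[->|k0 kk]; first by rewrite eqxx.
      apply/orP; right; rewrite /pol pk; apply: K_roots; first by rewrite k0.
      by move: pk => /orP[->|->]; rewrite ?orbT.
  - move=> k; rewrite mem_filter -andbA; split=> [/and3P[rk pk /K_itv]|[nP F0 kk]].
      by split=> //; [exact/negP|apply/eqP; rewrite -robin_rootE //; exact/negP].
    have rk : robin_root k by rewrite robin_rootE // F0.
    rewrite rk /=; apply/andP; split; first exact/negP.
    by apply: K_roots; rewrite // rk orbT.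
have split_robin : count robin_root K =
    (count (predI robin_root (predC pol)) K + count (predI neumann_root loop_root) K)%N.
  rewrite -(count_predUI (predI robin_root (predC pol)) (predI neumann_root loop_root)).
  rewrite [X in (_ + X)%N](_ : _ = 0%N) ?addn0; last first.
    apply/eqP; rewrite -leqn0 leqNgt -has_count; apply/hasP => -[k _] /=.
    by rewrite /pol; case: neumann_root; rewrite ?andbF.
  apply: eq_count => k /=; rewrite /pol.
  have [lk|lk] := boolP (loop_root k).
    by rewrite (robin_root_loop lk) orbT andbF andbT.
  rewrite orbF andbF orbF; have [nk|nk] := boolP (neumann_root k).
    by rewrite (negbTE (robin_root_neumann nk lk)).
  by rewrite andbT.
have := count_predUI neumann_root loop_root K.
move: zc; rewrite /= !size_filter split_robin => ->.
rewrite count_loop_root [count pol K](_ : _ = count (predU neumann_root loop_root) K) //.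
lia.
Qed.

End Interlacing.

Lemma sqr_inj_pos (R : realType) (x y : R) : 0 < x -> 0 < y -> x ^+ 2 = y ^+ 2 -> x = y.
Proof.
by move=> x0 y0 /eqP; rewrite eqrXn2 ?ltW // => /eqP.
Qed.

(** * Multiplicities and counting functions of the two graphs *)

Section LoopSpectrum.
Context {R : realType} (G : metric_graph R) (D : {set vertex G}).
Local Notation endpoint := (edge G * bool)%type.
Variables (v : vertex G) (x0 : endpoint) (l : R) (j : nat).
Hypotheses (x0v : vtx x0 = v) (x0_only : forall x, vtx x = v -> x = x0).
Hypothesis vD : v \notin D.
Hypotheses (l_gt0 : 0 < l) (j_gt0 : (0 < j)%N).
Local Notation Gv := (attach_loop v l_gt0).
Local Notation eig := (quasi D finset.set0).
Let kap : R := 2 * j%:R * pi / l.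
Variable dG : R -> nat.
Hypothesis dGE : forall z, has_dim (eigenspace_of D z) (dG z).

(** The balance of multiplicities at each frequency is summed over the frequencies below [kap], and
    the counts of Robin and loop roots are inserted. At [kap] itself the Robin and Neumann
    conditions coincide, leaving only the sine on the loop. *)
Lemma attach_loop_spectrum : exists dv : R -> nat,
  [/\ forall z, has_dim (@eigenspace_of R Gv D z) (dv z),
      forall b, exists2 t : seq R, uniq t & forall x, x \in t <-> dv x != 0%N /\ x <= b,
      forall b, exists2 x, b < x & dv x != 0%N,
      dv (kap ^+ 2) = (dG (kap ^+ 2)).+1 &
      exists t : seq R, [/\ uniq t,
        forall y, y < kap ^+ 2 -> dG y != 0%N -> y \in t,
        forall y, y < kap ^+ 2 -> dv y != 0%N -> y \in t &
        (count_below dv t (kap ^+ 2) + 1 =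
          count_below dG t (kap ^+ 2) + 2 * j)%N]].
Proof.
have [f [g [fg0 trace line reg pol]]] := weyl_function x0v x0_only vD.
pose A := neumann_root g; pose B := robin_root f g l; pose C := @loop_root R l.
have /choice[dv dvE] z : exists d : nat, [/\ has_dim (@eigenspace_of R Gv D z) d,
    z <= 0 -> d = dG z &
    forall k, 0 < k -> z = k ^+ 2 -> (d + A k = dG z + B k + C k)%N].
  have [z0|z0|->] := ltgtP z 0.
  - exists 0%N; split; first exact: (@has_dim_neg _ Gv).
      by move=> _; exact: has_dim_unique (has_dim_neg D z0) (dGE z).
    by move=> k _ zk; move: z0; rewrite zk ltNge sqr_ge0.
  - pose k := Num.sqrt z; have k0 : 0 < k by rewrite sqrtr_gt0.
    have zk : z = k ^+ 2 by rewrite sqr_sqrtr // ltW.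
    have [d [d' [hd hd' dd']]] :=
      has_dim_attach_loop x0v x0_only vD l_gt0 k0 (trace k) (line k).
    rewrite -zk in hd hd'; rewrite (has_dim_unique hd (dGE z)) in dd'.
    exists (d' + (sin (k * l / 2) == 0)%R)%N; split=> //.
    move=> k' k'0 zk'; have -> : k' = k by apply: sqr_inj_pos; rewrite -?zk'.
    move: dd'; rewrite /A /B /C /neumann_root /robin_root /loop_root.
    by do 3 case: (_ == _) => /=; lia.
  - exists (dG 0); split=> //; first exact: has_dim_attach_loop0 x0v x0_only vD _ _ (dGE 0).
    by move=> k k0 /esym/eqP; rewrite sqrf_eq0 gt_eqF.
(* A set of isolated frequencies containing every root and every positive frequency whose square is
   an eigenvalue of either graph; finiteness on bounded intervals follows. *)
pose S (t : R) := [\/ ~ (forall w, eig t w -> forall x, w x = 0), A t, B t | C t].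
have S_isolated (k : R) : \forall t \near k^', ~ S t.
  have h1 := eig_isolated x0v x0_only vD k.
  have h2 := neumann_root_isolated reg pol k.
  have h3 := robin_root_isolated l_gt0 reg pol k.
  have h4 := loop_root_isolated l_gt0 k.
  apply: filterS2 (filterI h1 h2) (filterI h3 h4) => t [e1 /negP e2] [/negP e3 /negP e4].
  by case.
have dG_S k : 0 < k -> dG (k ^+ 2) != 0%N -> S k.
  move=> k0 dk; constructor 1 => e0; case/negP: dk; apply/eqP.
  apply: has_dim_unique (dGE _) _; apply: has_dim0 => h /(eigenspace_wave k0)[w /e0 w0 hw].
  by move=> e x xe; rewrite hw // /wave !w0 !mul0r addr0.
have dv_S k : 0 < k -> dv (k ^+ 2) != 0%N -> S k.
  move=> k0; have [_ _ /(_ k k0 erefl) dk] := dvE (k ^+ 2).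
  have [Bk|nB] := boolP (B k); first by constructor 3.
  have [Ck|nC] := boolP (C k); first by constructor 4.
  move: dk; rewrite (negbTE nB) (negbTE nC) => dk dvk; apply: dG_S => //.
  by move: dvk dk; case: (A k) => /=; lia.
have neg0 z : z < 0 -> dG z = 0%N.
  by move=> z0; exact: has_dim_unique (dGE z) (has_dim_neg D z0).
have neg0v z : z < 0 -> dv z = 0%N.
  by move=> z0; have [_ /(_ (ltW z0)) -> _] := dvE z; exact: neg0.
have kap0 : 0 < kap by exact: kap_gt0.
have C_add k : 0 < k -> C k -> dv (k ^+ 2) = (dG (k ^+ 2)).+1.
  move=> k0 Ck; have [_ _ /(_ k k0 erefl)] := dvE (k ^+ 2).
  by rewrite Ck /B (robin_root_loop f g Ck) /A; lia.
exists dv; split.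
- by move=> z; have [] := dvE z.
- move=> b; have [K uK KE] := isolated_segment_seq 0 (1 + `|b|) S_isolated.
  exists (undup [seq z <- 0 :: [seq k ^+ 2 | k <- K] | (dv z != 0%N) && (z <= b)]).
    exact: undup_uniq.
  move=> z; rewrite mem_undup mem_filter; split; first by case/andP=> /andP[].
  move=> [dz zb]; rewrite dz zb /=.
  have z0 : 0 <= z by rewrite leNgt; apply/negP => /neg0v dz0; rewrite dz0 in dz.
  move: z0; rewrite inE le_eqVlt => /predU1P[<-|z0]; first by rewrite eqxx.
  apply/orP; right; apply/mapP.
  have k0 : 0 < Num.sqrt z by rewrite sqrtr_gt0.
  have zk : z = Num.sqrt z ^+ 2 by rewrite sqr_sqrtr // ltW.
  exists (Num.sqrt z) => //; apply/KE; split; first by apply: dv_S; rewrite -?zk.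
  rewrite (ltW k0) /= leNgt; apply/negP => kb.
  have := ler_norm b; have := normr_ge0 b; move: zb; rewrite zk; nra.
(* Loop roots supply arbitrarily large eigenvalues; [i] is large enough for the root to exceed
   [1 + |b|], so that its square exceeds [b]. *)
- move=> b; pose i := (Num.truncn (l * (1 + `|b|))).+1.
  pose k : R := 2 * i%:R * pi / l.
  have bk : 1 + `|b| < k.
    rewrite /k ltr_pdivlMr // mulrC.
    have := truncnS_gt (l * (1 + `|b|)); rewrite -/i => hi.
    have := pi_ge2 R; have : 0 <= i%:R :> R by []; nra.
  have k0 : 0 < k by apply: lt_trans bk; rewrite ltr_pwDl.
  exists (k ^+ 2).
    have := ler_norm b; have := normr_ge0 b; nra.
  rewrite C_add //; apply/(loop_rootP l_gt0); first exact: ltW.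
  by exists i.
- by apply: C_add => //; exact: loop_root_kap.
have [K0 uK0 K0E] := isolated_segment_seq 0 kap S_isolated.
(* Both ends are removed: the eigenvalue 0 is counted apart, and [kap ^+ 2] is not below itself. *)
pose K := [seq k <- K0 | 0 < k < kap].
have uK : uniq K by exact: filter_uniq.
have K_itv k : k \in K -> 0 < k < kap by rewrite mem_filter => /andP[].
have K_S k : 0 < k < kap -> S k -> k \in K.
  move=> kk Sk; rewrite mem_filter kk /=; apply/K0E; split=> //.
  by case/andP: kk => /ltW -> /ltW.
have K_roots k : 0 < k < kap -> [|| A k, B k | C k] -> k \in K.
  by move=> kk /or3P h; apply: K_S => //; case: h; [constructor 2|constructor 3|constructor 4].
have sqr_K d : (forall z, z < 0 -> d z = 0%N) ->
    (forall k, 0 < k -> d (k ^+ 2) != 0%N -> S k) ->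
    forall y, y < kap ^+ 2 -> d y != 0%N -> y \in 0 :: [seq k ^+ 2 | k <- K].
  move=> dneg dS y yk dy.
  have y0 : 0 <= y by rewrite leNgt; apply/negP => /dneg dy0; rewrite dy0 in dy.
  move: y0; rewrite inE le_eqVlt => /predU1P[<-|y0]; first by rewrite eqxx.
  apply/orP; right; apply/mapP.
  have k0 : 0 < Num.sqrt y by rewrite sqrtr_gt0.
  have yE : y = Num.sqrt y ^+ 2 by rewrite sqr_sqrtr // ltW.
  exists (Num.sqrt y) => //; apply: K_S; last by apply: dS; rewrite -?yE.
  by rewrite k0 /= -(ltr_pXn2r (n := 2)) ?nnegrE ?ltW // -yE.
exists (0 :: [seq k ^+ 2 | k <- K]); split.
- rewrite /= map_inj_in_uniq ?uK ?andbT.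
    apply/negP => /mapP[k /K_itv/andP[k0 _] /esym/eqP].
    by rewrite sqrf_eq0 gt_eqF.
  by move=> x y /K_itv/andP[x0' _] /K_itv/andP[y0 _]; exact: sqr_inj_pos.
- exact: sqr_K.
- exact: sqr_K.
have cE d : count_below d (0 :: [seq k ^+ 2 | k <- K]) (kap ^+ 2) =
    (d 0%R + \sum_(k <- K) d (k ^+ 2)%R)%N.
  rewrite /count_below big_cons exprn_gt0 // big_map; congr (_ + _)%N.
  rewrite -big_filter (eq_in_filter (a2 := predT)) ?filter_predT // => k /K_itv/andP[k0 kk].
  by rewrite ltr_pXn2r // nnegrE ltW.
have cntE (a : pred R) : count a K = (\sum_(k <- K) a k)%N.
  by rewrite -sum1_count big_mkcond; apply: eq_bigr => k _; case: (a k).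
have sumE : (\sum_(k <- K) dv (k ^+ 2)%R + count A K =
    \sum_(k <- K) dG (k ^+ 2)%R + count B K + count C K)%N.
  rewrite !cntE -!big_split; apply: eq_big_seq => k /K_itv/andP[k0 _] /=.
  by have [_ _ ->] := dvE (k ^+ 2).
have cB := count_robin_root l_gt0 j_gt0 fg0 reg pol uK K_itv K_roots.
have cC := count_loop_root l_gt0 j_gt0 uK K_itv K_roots.
have [_ /(_ (lexx 0)) dv0 _] := dvE 0.
move: sumE; rewrite !cE cB cC dv0 -/A.
move: j_gt0; lia.
Qed.

End LoopSpectrum.

(** * Sharpness *)

Section GraphInvariants.
Context {R : realType} (G : metric_graph R).

(** Connectedness makes the left kernel of the incidence matrix consist of constant rows, so its
    rank is at least the number of vertices minus one, and at most the number of edges. *)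
Lemma connected_betti_ge0 (v : vertex G) : connected_graph G -> 0 <= betti G.
Proof.
move=> conn; pose V := vertex G; pose E := edge G.
pose M : 'M[R]_(#|V|, #|E|) := \matrix_(a, e)
  ((vtx (enum_val e, true) == enum_val a)%:R - (vtx (enum_val e, false) == enum_val a)%:R).
have ME (r : 'rV[R]_#|V|) e : (r *m M) 0 e =
    r 0 (enum_rank (vtx (enum_val e, true))) - r 0 (enum_rank (vtx (enum_val e, false))).
  have pick u : \sum_a r 0 a * (u == enum_val a :> V)%:R = r 0 (enum_rank u).
    rewrite (bigD1 (enum_rank u)) //= enum_rankK eqxx mulr1 big1 ?addr0 // => a au.
    case: eqP => [uE|]; last by rewrite mulr0.
    by rewrite uE enum_valK eqxx in au.
  by rewrite mxE -!pick -sumrB; apply: eq_bigr => a _; rewrite mxE mulrBr.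
have : (kermx M <= (const_mx 1 : 'rV[R]_#|V|))%MS.
  apply/rV_subP => r /sub_kermxP rM.
  have adj (u w : V) : Defs.adjacent u w -> r 0 (enum_rank u) = r 0 (enum_rank w).
    move=> /existsP[e /existsP[b /andP[/eqP <- /eqP <-]]].
    have := ME r (enum_rank e); rewrite rM mxE enum_rankK => /esym/subr0_eq h.
    by case: b.
  have cst (u w : V) : r 0 (enum_rank u) = r 0 (enum_rank w).
    have /connectP[p] := conn u w.
    elim: p u => [|a p IH] u /=; first by move=> _ ->.
    by move=> /andP[/adj -> ap] wE; exact: IH.
  apply/submxP; exists (const_mx (r 0 (enum_rank v)) : 'M[R]_1).
  apply/rowP => a; rewrite !mxE big_ord1 !mxE mulr1.
  by rewrite -(cst (enum_val a)) enum_valK.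
move=> /mxrankS; rewrite mxrank_ker => h.
have := rank_leq_row (const_mx 1 : 'rV[R]_#|V|); have := rank_leq_col M.
by rewrite /betti -/V -/E; lia.
Qed.

Lemma eigenspace_constant : eigenspace_of (finset.set0 : {set vertex G}) 0 (fun _ _ => 1).
Proof.
exists (fun _ _ => 0), (fun _ _ => 0); split=> //.
- move=> e; apply: smooth_sobolev2 => [|x]; [exact: endpt_lt|exact: cvg_cst].
- by move=> e b; rewrite inE.
- by move=> u _; rewrite big1 // => x _; rewrite mulr0.
- by move=> e; apply: aeW => x _; rewrite mul0r oppr0.
Qed.

Lemma total_length_gt0 (v : vertex G) : 0 < total_length G.
Proof.
have [[e b] _] := vtx_surj v; rewrite /total_length (bigD1 e) //=.
rewrite ltr_pwDl ?subr_gt0 ?endpt_lt //.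
by apply: sumr_ge0 => e' _; rewrite subr_ge0 ltW // endpt_lt.
Qed.

Variables (v : vertex G) (l : R) (l_gt0 : 0 < l).
Local Notation Gv := (attach_loop v l_gt0).

Lemma total_length_attach_loop : total_length Gv = total_length G + l.
Proof. by rewrite /total_length sum_option /= subr0 addrC. Qed.

Lemma betti_attach_loop : betti Gv = betti G + 1.
Proof.
have eE : #|edge Gv| = #|edge G|.+1 by exact: card_option.
by rewrite /betti eE -[#|vertex Gv|]/#|vertex G| intS; ring.
Qed.

Lemma degree_attach_loop (u : vertex G) :
  @degree R Gv u = (degree u + (u == v).*2)%N.
Proof.
have natE (H : metric_graph R) (w : vertex H) : (degree w)%:R =
    \sum_(x : edge H * bool | vtx x == w) 1 :> R.
  by rewrite sumr_const.
apply/eqP; rewrite -(eqr_nat R) natrD !natE sum_loop_vertex.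
by apply/eqP; congr (_ + _); case: (u == v).
Qed.

Lemma nNeumann_attach_loop (D : {set vertex G}) : v \in pendants G :\: D ->
  nNeumann D = (@nNeumann R Gv D).+1.
Proof.
move=> vN; rewrite /nNeumann (cardsD1 v) vN add1n; congr (_.+1).
apply: eq_card => u; rewrite !inE degree_attach_loop.
have [->|uv] := eqVneq u v; last by rewrite addn0.
by move: vN; rewrite !inE => /andP[_ /eqP ->]; rewrite andbF.
Qed.

End GraphInvariants.

Lemma eigenval_spectrum (R : realType) (G : metric_graph R) (D : {set vertex G}) :
  (exists s, is_spectrum D s) -> exists2 s, is_spectrum D s &
    forall n, eigenval D n = s n.-1.
Proof.
move=> [s0 sp0]; exists (xget (fun=> 0) [set s : nat -> R | is_spectrum D s]) => //.
exact: (@xgetPex _ (fun=> 0) [set s : nat -> R | is_spectrum D s] (ex_intro _ s0 sp0)).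
Qed.

(** Without a spectrum [eigenval] would take its default value 0, which is not the positive
    [lam]. *)
Lemma eigenvalue_at_spectrum (R : realType) (G : metric_graph R) (D : {set vertex G})
    (lam : R) (n m : nat) : 0 < lam -> eigenvalue_at D lam n m ->
  exists2 s, is_spectrum D s & forall n, eigenval D n = s n.-1.
Proof.
move=> lam0 [n0 m0 eE]; have [ex|nex] := pselect (exists s, is_spectrum D s).
  exact: eigenval_spectrum.
have := (eE n n0).2; rewrite /eigenval xgetPN => [h|s sp]; last by apply: nex; exists s.
by move: lam0; rewrite -h ?ltxx // leqnn -[X in (X < _)%N]addn0 ltn_add2l.
Qed.

(* [sqrt lam * total_length / pi] is additive under attaching the loop. *)
Lemma bound_shift (R : realType) (lam L l i c : R) : 0 < lam -> 0 < L -> 0 < l ->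
  Num.sqrt lam * l = pi * i -> 0 < c -> lam = pi ^+ 2 / L ^+ 2 * c ^+ 2 ->
  Num.sqrt lam * L = pi * c /\ lam = pi ^+ 2 / (L + l) ^+ 2 * (c + i) ^+ 2.
Proof.
move=> lam0 L0 l0 ql c0 lamE; have pi0 := pi_gt0 R.
have q0 : 0 < Num.sqrt lam by rewrite sqrtr_gt0.
have q2 : Num.sqrt lam ^+ 2 = lam by rewrite sqr_sqrtr // ltW.
move: pi (Num.sqrt lam) q0 q2 pi0 ql lamE => p q q0 q2 p0 ql lamE.
have qL : q * L = p * c.
  apply: sqr_inj_pos; [exact: mulr_gt0|exact: mulr_gt0|].
  by rewrite !exprMn q2 lamE; field; rewrite gt_eqF.
split=> //; have Ll0 : L + l != 0 by rewrite gt_eqF // addr_gt0.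
have qLl : q * (L + l) = p * (c + i) by rewrite mulrDr qL ql -mulrDr.
have -> : p ^+ 2 / (L + l) ^+ 2 * (c + i) ^+ 2 = (p * (c + i)) ^+ 2 / (L + l) ^+ 2.
  by field.
by rewrite -qLl -[LHS]q2; field.
Qed.

Theorem lemma3p3 (R : realType) (G : metric_graph R) (D : {set vertex G})
  (G_connected : connected_graph G) (D_pendant : D \subset pendants G)
  (v : vertex G) (v_neumann : v \in pendants G :\: D)
  (lam : R) (lam_gt0 : 0 < lam) (n m : nat)
  (lam_sharp : sharp_eigenvalue D lam n m)
  (j : nat) (j_ge1 : (1 <= j)%N)
  (l : R) (l_gt0 : 0 < l) (l_def : l = 2 * j%:R * pi / Num.sqrt lam) :
  @sharp_degenerate_eigenvalue R (attach_loop v l_gt0) D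
    lam (n + 2 * j - 1)%N m.+1.
Proof.
have [lam_at [_ up] [_ low]] := lam_sharp; have [n0 m0 eE] := lam_at.
have nm0 : (0 < n + m - 1)%N by clear -n0 m0; lia.
have [vD pv] : v \notin D /\ degree v = 1%N.
  by move: v_neumann; rewrite !inE => /andP[-> /eqP].
have [x0 x0E] : exists x0, forall x, (vtx x == v) = (x == x0).
  by have [x0 x0E] := mem_card1 pv; exists x0 => x; have := x0E x; rewrite !inE.
have x0v : vtx x0 = v by apply/eqP; rewrite x0E.
have x0_only x : vtx x = v -> x = x0 by move=> /eqP; rewrite x0E => /eqP.
have [s [s_mono sE] sEig] := eigenvalue_at_spectrum lam_gt0 lam_at.
have [dG dGE] := choice sE.
have [dv [dvE dv_fin dv_unb dv_lam [t [ut tG tv cnt]]]] :=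
  attach_loop_spectrum x0v x0_only vD l_gt0 j_ge1 (fun z => (dGE z).1).
have sq0 : 0 < Num.sqrt lam by rewrite sqrtr_gt0.
have kapE : (2 * j%:R * pi / l) ^+ 2 = lam.
  rewrite -[RHS]sqr_sqrtr ?ltW //; congr (_ ^+ 2); rewrite l_def.
  have j0 : (j%:R : R) != 0 by rewrite pnatr_eq0 -lt0n.
  move: (lt0r_neq0 (pi_gt0 R)) (lt0r_neq0 sq0) j0.
  by move: pi (Num.sqrt lam) (j%:R : R) => p q i p0 q0 i0; field; rewrite p0 q0.
rewrite kapE in dv_lam tG tv cnt.
have s_lam i : s i = lam <-> (n <= i.+1 < n + m)%N by have := eE i.+1 isT; rewrite sEig.
have dG_lam0 : dG lam != 0%N.
  by apply/(card_fiber_neq0 (dGE lam).2); exists n.-1; apply/s_lam; lia.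
have s_fib := monotone_fiber s_mono (fun z => (dGE z).2) ut tG dG_lam0.
(* Two descriptions of one block of indices; the predecessor appears because [s] is indexed from 0
   and [eigenval] from 1. *)
have [cG dG_lam] : count_below dG t lam = n.-1 /\ dG lam = m.
  have i1 i : (n <= i.+1 < n + m)%N <->
      (count_below dG t lam <= i < count_below dG t lam + dG lam)%N.
    exact: iff_trans (iff_sym (s_lam i)) (s_fib i).
  have h1 := (i1 n.-1).1; have h2 := (i1 (n + m).-2).1.
  have h3 := (i1 (count_below dG t lam)).2.
  have h4 := (i1 (count_below dG t lam + dG lam).-1).2.
  move: dG_lam0 n0 m0 h1 h2 h3 h4; clear; lia.
have [s' [s'_mono s'_fib]] := enumeration_exists dv_fin dv_unb.
have [sv [sv_mono svE] svEig] : exists2 s, @is_spectrum R (attach_loop v l_gt0) D s &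
    forall n, @eigenval R (attach_loop v l_gt0) D n = s n.-1.
  by apply: eigenval_spectrum; exists s'; split=> // z; exists (dv z).
have sv_fib z : ([set i | sv i = z] #= `I_(dv z))%card.
  by have [d [dd]] := svE z; rewrite (has_dim_unique dd (dvE z)).
have dv0 : dv lam != 0%N by rewrite dv_lam.
have sv_lam := monotone_fiber sv_mono sv_fib ut tv dv0.
have cv : count_below dv t lam = (n + 2 * j - 2)%N.
  by move: cnt; rewrite cG; lia.
have at_v : @eigenvalue_at R (attach_loop v l_gt0) D lam (n + 2 * j - 1) m.+1.
  split=> //; first by lia.
  move=> k k1; rewrite svEig; apply: iff_trans (sv_lam k.-1) _.
  by rewrite cv dv_lam dG_lam; lia.
have beta0 := connected_betti_ge0 v G_connected.
have L0 := total_length_gt0 v.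
have betaE := betti_attach_loop v l_gt0.
have NE := nNeumann_attach_loop l_gt0 v_neumann.
have LE := total_length_attach_loop v l_gt0.
(* This makes the base of the upper bound positive. If [D] is empty, the constants give the
   eigenvalue 0, so the positive [lam] cannot have index 1. *)
have nD : (2 <= n + nDirichlet D)%N.
  have [D0|] := eqVneq (nDirichlet D) 0%N; last by clear -n0; lia.
  rewrite D0 addn0 ltn_neqAle n0 andbT; apply/eqP => n1.
  move/eqP: D0; rewrite cards_eq0 => /eqP D0.
  have : dG 0 != 0%N.
    apply/eqP => d0; have [h _] := dGE 0; move: h; rewrite d0 => -[f [_ _ fsp]].
    have [|c] := fsp (fun _ _ => 1); first by rewrite D0; exact: eigenspace_constant.
    move=> /(_ x0.1 _ (endpt_itv x0.1 false)) /eqP.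
    by rewrite /lin_comb big_ord0 oner_eq0.
  move=> /(card_fiber_neq0 (dGE 0).2)[i si].
  have := s_mono 0%N i isT; rewrite si (s_lam 0%N).2; last by rewrite -n1; clear -m0; lia.
  by rewrite leNgt lam_gt0.
have eig_n : eigenval D n = lam by apply/(eE n n0); clear -m0; lia.
have eig_nm : eigenval D (n + m - 1) = lam by apply/eE => //; clear -n0 m0; lia.
have [_ _ eEv] := at_v.
have eigv_n : @eigenval R (attach_loop v l_gt0) D (n + 2 * j - 1) = lam.
  by apply/eEv; clear -n0 j_ge1; lia.
have eigv_nm : @eigenval R (attach_loop v l_gt0) D (n + 2 * j - 1 + m.+1 - 1) = lam.
  by apply/eEv; clear -n0 j_ge1; lia.
move: up low; rewrite eig_n eig_nm /upper_bound /lower_bound.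
set b : R := (betti G)%:~R; set N : R := (nNeumann D)%:R.
set Dn : R := (nDirichlet D)%:R; set L := total_length G => up low.
have b0 : 0 <= b by rewrite ler0z.
have N1 : 1 <= N by rewrite /N NE ler1n.
have nDR : 2 <= n%:R + Dn by rewrite -natrD (ler_nat R 2).
have q2 : Num.sqrt lam ^+ 2 = lam by rewrite sqr_sqrtr // ltW.
have pi0 := pi_gt0 R.
have ql : Num.sqrt lam * l = pi * (2 * j%:R).
  by rewrite l_def mulrC divfK ?gt_eqF // mulrC.
have base := bound_shift lam_gt0 L0 l_gt0 ql.
have u0 : 0 < n%:R - 2 + Dn + (N + b) / 2 + b by clear -nDR N1 b0; lra.
have [qLu upv] := base _ u0 up.
have nN1 : (0 < nNeumann D)%N by rewrite NE.
(* On the first branch of the lower bound, equality of the two sharp values would give n - 2 + Dn +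
   (N + b) / 2 + b = (n + m - 1) / 2 < (N + b) / 2, although n + Dn is at least 2 and b is
   nonnegative. *)
have ge_beta : (n + m - 1)%N%:Z < (nNeumann D)%:Z + betti G = false.
  apply/negP => lt_beta; move: low; rewrite lt_beta => low.
  have c0 : 0 < (n + m - 1)%N%:R / 2 :> R by rewrite divr_gt0 // ltr0n.
  have [|qLc _] := base _ c0; first by rewrite low expr_div_n -[2 ^+ 2]natrX.
  have : (n + m - 1)%N%:R < N + b.
    by move: lt_beta; rewrite -(ltr_int R) intrD.
  have : pi * (n%:R - 2 + Dn + (N + b) / 2 + b) = pi * ((n + m - 1)%N%:R / 2).
    by rewrite -qLu -qLc.
  move=> /(mulfI (lt0r_neq0 pi0)).
  by clear -b0 nDR; lra.
have ge_betaR : N + b <= (n + m - 1)%N%:R.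
  by move/negbT: ge_beta; rewrite -leNgt -(ler_int R) intrD.
have w0 : 0 < (n + m - 1)%N%:R - (N + b) / 2 by clear -ge_betaR N1 b0; lra.
move: low; rewrite ge_beta => /(base _ w0)[_ lowv].
have NR : (@nNeumann R (attach_loop v l_gt0) D)%:R = N - 1 :> R.
  by rewrite /N NE -natr1 addrK.
have n2j0 : (0 < n + 2 * j)%N by clear -n0; lia.
have n2jE : (n + 2 * j - 1)%N%:R = n%:R + 2 * j%:R - 1 :> R.
  by rewrite natrB // natrD natrM.
have nm2jE : (n + 2 * j - 1 + m.+1 - 1 = n + m - 1 + 2 * j)%N by clear -n0; lia.
split; last by [].
split=> //; split.
- by clear -n0 j_ge1; lia.
(* The base grows by [2 j], as [bound_shift] requires: the index contributes [2 j - 1] and the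
   separate Betti term 1, while N + b is unchanged. *)
- rewrite eigv_n /upper_bound betaE LE NR intrD -/b -/Dn -/L upv n2jE.
  by congr (_ * _ ^+ 2); field.
- by left; rewrite nm2jE; clear -j_ge1; lia.
(* The threshold N + b is unchanged, since [v] stops being pendant while the loop raises the Betti
   number; the larger index stays on the second branch. *)
rewrite eigv_nm nm2jE /lower_bound betaE LE NR intrD -/b -/L ifF; last first.
  by apply/negP; move: ge_beta NE => /negbT; clear; lia.
rewrite {1}lowv natrD natrM; congr (_ * _ ^+ 2).
by move: ((n + m - 1)%N%:R : R) => y; field.
Qed.
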